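(* Let $k,r\ge 1$. There is a functorial assignment $X\mapsto\Delta^{k,r}(X)$ from affine varieties to varieties over $((\mathbb{C}^r)^k)^{\circ}$ (i.e. a functor from the category of affine varieties over $\mathbb{C}$ to the category of varieties equipped with a morphism to $((\mathbb{C}^r)^k)^{\circ}$) such that, for every affine variety $X$ and every $\overline{P}=(\overline{m_1},\ldots,\overline{m_k})\in(\mathbb{Z}_{\ge0}^r\setminus\{\overline{0}\})^k\subset((\mathbb{C}^r)^k)^{\circ}$, the reduced fiber of $\Delta^{k,r}(X)$ over $\overline P$ is precisely the $r$-colored $(\overline{m_1},\ldots,\overline{m_k})$-incidence stratum $$\Delta^{k,r}_{\overline{P}}(X)\subset \mathrm{Sym}^{(\overline{m_1})_1+\ldots+(\overline{m_k})_1}X\times\cdots\times\mathrm{Sym}^{(\overline{m_1})_r+\ldots+(\overline{m_k})_r}X.$$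
   Context: Everything is over $\mathbb{C}$; varieties are reduced, of finite type, not necessarily irreducible. For $\overline m\in\mathbb{C}^r$, $(\overline m)_j$ is its $j$-th coordinate. $$((\mathbb{C}^r)^k)^{\circ}=(\mathbb{C}^r)^k\setminus\bigcup_{\emptyset\ne S\subset\{1,\ldots,k\}}\Big\{(\overline{m_1},\ldots,\overline{m_k}):\sum_{i\in S}\overline{m_i}=\overline 0\Big\}.$$ $\mathrm{Sym}^dX=X^d/S_d$ is the variety of unordered $d$-tuples of points of $X$ (effective zero-cycles of degree $d$). For $\overline P=(\overline{m_1},\ldots,\overline{m_k})\in(\mathbb{Z}_{\ge0}^r\setminus\{\overline0\})^k$ with $\overline{m_1}+\cdots+\overline{m_k}=(d_1,\ldots,d_r)$, the $r$-colored incidence stratum $\Delta^{k,r}_{\overline P}(X)\subset\prod_{j=1}^r\mathrm{Sym}^{d_j}X$ is the closed subvariety, with reduced structure, of all $r$-tuples of zero-cycles $\big(\sum_{i=1}^k(\overline{m_i})_1x_i,\ldots,\sum_{i=1}^k(\overline{m_i})_rx_i\big)$ with $x_1,\ldots,x_k\in X$ not necessarily distinct. The reduced fiber is the scheme-theoretic fiber with its reduced structure. *)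

(* Defs.v *)
From HB Require Import structures.
From mathcomp Require Import all_boot all_order all_algebra.
From mathcomp Require Import boolp classical_sets functions topology.
From mathcomp Require Import reals complex.

Set Implicit Arguments.
Unset Strict Implicit.
Unset Printing Implicit Defensive.

Import GRing.Theory.
Local Open Scope classical_set_scope.
Local Open Scope ring_scope.

(* Varieties are treated classically, as in Serre's FAC: a variety over an
   algebraically closed field K (reduced, separated, of finite type, possibly
   reducible) is its set of closed points with the Zariski topology and the
   sheaf of regular K-valued functions.  A regular function on U is a total
   function of which only the restriction to U matters. *)

Record is_fspace (K : fieldType) (T : topologicalType)
    (reg : set T -> (T -> K) -> Prop) : Prop := IsFspace {
  reg_ext : forall U f g, (forall x, U x -> f x = g x) -> reg U f -> reg U g;
  reg_res : forall U V f, open V -> V `<=` U -> reg U f -> reg V f;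
  reg_glue : forall U f,
    (forall x, U x -> exists V, [/\ open V, V x, V `<=` U & reg V f]) ->
    reg U f;
  reg_cst : forall U c, open U -> reg U (fun=> c);
  reg_add : forall U f g, open U -> reg U f -> reg U g ->
    reg U (fun x => f x + g x);
  reg_mul : forall U f g, open U -> reg U f -> reg U g ->
    reg U (fun x => f x * g x);
  reg_inv : forall U f, open U -> reg U f ->
    open (U `&` [set x | f x != 0]) /\
    reg (U `&` [set x | f x != 0]) (fun x => (f x)^-1) }.

Record fspace (K : fieldType) := Fspace {
  fsort :> topologicalType;
  reg : set fsort -> (fsort -> K) -> Prop;
  fspaceP : is_fspace reg }.

Definition is_morph (K : fieldType) (X Y : fspace K) (f : X -> Y) : Prop :=
  continuous f /\
  forall (U : set Y) (g : Y -> K),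
    open U -> reg U g -> reg (f @^-1` U) (g \o f).

Record morph (K : fieldType) (X Y : fspace K) := Morph {
  mfun :> X -> Y;
  morphP : is_morph mfun }.

Lemma is_morph_id (K : fieldType) (X : fspace K) : is_morph (@id X).
Proof. by split=> // x. Qed.

Lemma is_morph_comp (K : fieldType) (X Y Z : fspace K) (g : morph Y Z)
  (f : morph X Y) : is_morph (g \o f).
Proof.
case: (morphP f) (morphP g) => cf rf [cg rg]; split.
  by move=> x; apply: continuous_comp; [exact: cf | exact: cg].
move=> U h oU hU; apply: (rf (g @^-1` U) (h \o g)); last exact: rg.
by move/continuousP: cg; apply.
Qed.

Definition morph_id (K : fieldType) (X : fspace K) : morph X X :=
  Morph (is_morph_id X).

Definition morph_comp (K : fieldType) (X Y Z : fspace K) (g : morph Y Z)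
  (f : morph X Y) : morph X Z := Morph (is_morph_comp g f).

Record iso (K : fieldType) (X Y : fspace K) := Iso {
  iso_fwd :> morph X Y;
  iso_bwd : morph Y X;
  iso_fwdK : cancel iso_fwd iso_bwd;
  iso_bwdK : cancel iso_bwd iso_fwd }.

(* Copy of T, to carry the topology generated by base. *)
Definition gen_top (K : fieldType) (T : choiceType)
  (base : set T -> (T -> K) -> Prop) : Type := T.

Section Generated.
Variables (K : fieldType) (T : choiceType).
Variable base : set T -> (T -> K) -> Prop.

(* [gen_loc U f]: f is, on U, a polynomial in local functions of [base] whose
   domains contain U.  The space generated by [base] is the coarsest one in
   which these are regular: its open sets are the unions of the sets
   {y in U | h y <> 0} and its regular functions are locally of the form g / h,
   with g and h such polynomials. *)
Inductive gen_loc : set T -> (T -> K) -> Prop :=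
| gen_base U f : base U f -> gen_loc U f
| gen_cst c : gen_loc setT (fun=> c)
| gen_add U V f g : gen_loc U f -> gen_loc V g ->
    gen_loc (U `&` V) (fun x => f x + g x)
| gen_mul U V f g : gen_loc U f -> gen_loc V g ->
    gen_loc (U `&` V) (fun x => f x * g x).

Definition gen_open (W : set T) : Prop :=
  forall x, W x -> exists U h,
    [/\ gen_loc U h, U x, h x != 0 & U `&` [set y | h y != 0] `<=` W].

Definition gen_reg (W : set T) (f : T -> K) : Prop :=
  forall x, W x -> exists U g h,
    [/\ gen_loc U g, gen_loc U h, U x, h x != 0 &
        forall y, U y -> h y != 0 -> W y /\ f y = g y / h y].

Lemma gen_openT : gen_open setT.
Proof.
move=> x _; exists setT, (fun=> 1).
by split=> //; [exact: gen_cst | exact: oner_neq0].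
Qed.

Lemma gen_openI : setI_closed gen_open.
Proof.
move=> A B oA oB x [/oA[U [h [lh Ux hx sA]]] /oB[V [k [lk Vx kx sB]]]].
exists (U `&` V), (fun x => h x * k x).
split; [exact: gen_mul | by [] | by rewrite mulf_neq0 |].
move=> y [[Uy Vy]] /=; rewrite mulf_eq0 negb_or => /andP[hy ky].
by split; [apply: sA | apply: sB].
Qed.

Lemma gen_open_bigU (I : Type) (f : I -> set T) :
  (forall i, gen_open (f i)) -> gen_open (\bigcup_i f i).
Proof.
move=> of_ x [i _ /of_[U [h [lh Ux hx sf]]]].
by exists U, h; split=> // y /sf fy; exists i.
Qed.

HB.instance Definition _ := Choice.on (gen_top base).
HB.instance Definition _ :=
  isOpenTopological.Build (gen_top base) gen_openT gen_openI gen_open_bigU.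

Lemma gen_openE (W : set (gen_top base)) : open W = gen_open W.
Proof. by []. Qed.

Lemma gen_fspaceP : @is_fspace K (gen_top base) gen_reg.
Proof.
have simp U V g h : gen_loc U g -> gen_loc V h ->
    gen_loc (U `&` V) (fun x => g x) /\ gen_loc (U `&` V) (fun x => h x).
  move=> lg lh; have l0 W k : gen_loc W k -> gen_loc W (fun=> 0).
    move=> lk; rewrite -[W]setIT.
    rewrite (_ : (fun=> 0) = fun x => k x * 0); first exact/gen_mul/gen_cst.
    by apply/funext => x; rewrite mulr0.
  split.
    rewrite (_ : (fun x => g x) = fun x => g x + 0); first exact/gen_add/l0/lh.
    by apply/funext => x; rewrite addr0.
  rewrite (_ : (fun x => h x) = fun x => 0 + h x); last first.
    by apply/funext => x; rewrite add0r.
  by apply: gen_add => //; exact: l0 lg.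
split.
- move=> U f g fg rf x /[dup] Ux /rf[V [a [b [la lb Vx bx ab]]]].
  exists V, a, b; split=> // y Vy by0.
  by have [Uy <-] := ab _ Vy by0; split=> //; rewrite fg.
- move=> U V f oV VU rf x Vx; have [A [h [lh Ax hx sV]]] := oV _ Vx.
  have [B [a [b [la lb Bx bx ab]]]] := rf _ (VU _ Vx).
  exists (B `&` A), (fun x => a x * h x), (fun x => b x * h x).
  split=> //; [exact: gen_mul | exact: gen_mul | by rewrite mulf_neq0 |].
  move=> y [By Ay]; rewrite mulf_eq0 negb_or => /andP[by0 hy].
  split; first exact: sV.
  by have [_ ->] := ab _ By by0; rewrite -mulf_div divff // mulr1.
- move=> U f loc x /loc[V [_ Vx VU rf]].
  have [B [a [b [la lb Bx bx ab]]]] := rf _ Vx.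
  exists B, a, b; split=> // y By by0.
  by have [Vy ->] := ab _ By by0; split=> //; exact: VU.
- move=> U c oU x Ux; have [A [h [lh Ax hx sU]]] := oU _ Ux.
  exists A, (fun x => c * h x), h; split=> //.
    by rewrite -[A]setTI; exact/gen_mul/lh/gen_cst.
  by move=> y Ay hy; split; [exact: sU | rewrite mulfK].
- move=> U f g oU rf rg x Ux.
  have [A [a [b [la lb Ax bx ab]]]] := rf _ Ux.
  have [B [c [d [lc ld Bx dx cd]]]] := rg _ Ux.
  exists (A `&` B), (fun x => a x * d x + c x * b x), (fun x => b x * d x).
  split=> //; [|exact: gen_mul|by rewrite mulf_neq0|].
    rewrite -[A `&` B]setIid; apply: gen_add; first exact: gen_mul.
    by rewrite setIC; exact: gen_mul.
  move=> y [Ay By]; rewrite mulf_eq0 negb_or => /andP[by0 dy0].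
  have [Uy ->] := ab _ Ay by0; have [_ ->] := cd _ By dy0.
  by split=> //; rewrite addf_div.
- move=> U f g oU rf rg x Ux.
  have [A [a [b [la lb Ax bx ab]]]] := rf _ Ux.
  have [B [c [d [lc ld Bx dx cd]]]] := rg _ Ux.
  exists (A `&` B), (fun x => a x * c x), (fun x => b x * d x).
  split=> //; [exact: gen_mul|exact: gen_mul|by rewrite mulf_neq0|].
  move=> y [Ay By]; rewrite mulf_eq0 negb_or => /andP[by0 dy0].
  have [Uy ->] := ab _ Ay by0; have [_ ->] := cd _ By dy0.
  by split=> //; rewrite mulf_div.
- move=> U f oU rf.
  have key x : U x -> f x != 0 -> exists A a b,
      [/\ gen_loc A a, gen_loc A b, A x, a x * b x != 0 &
      forall y, A y -> a y * b y != 0 ->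
        [/\ U y, f y != 0 & (f y)^-1 = b y / a y]].
    move=> Ux fx; have [A [a [b [la lb Ax bx ab]]]] := rf _ Ux.
    exists A, a, b; split=> //.
      rewrite mulf_neq0 //; have [_ fE] := ab _ Ax bx.
      by apply: contra_neq fx => a0; rewrite fE a0 mul0r.
    move=> y Ay; rewrite mulf_eq0 negb_or => /andP[ay by0].
    have [Uy fE] := ab _ Ay by0.
    by split=> //; rewrite fE ?invf_div // mulf_neq0 ?invr_eq0.
  rewrite gen_openE; split=> x [Ux /= fx]; have [A [a [b [la lb Ax nz ab]]]] := key _ Ux fx.
    exists A, (fun x => a x * b x); split=> //.
      by rewrite -[A]setIid; exact: gen_mul.
    by move=> y [Ay aby]; have [? ? _] := ab _ Ay aby.
  exists A, (fun x => b x * b x), (fun x => a x * b x); split=> //.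
  - by rewrite -[A]setIid; exact: gen_mul.
  - by rewrite -[A]setIid; exact: gen_mul.
  move=> y Ay aby; have [? ? ->] := ab _ Ay aby; split=> //.
  by rewrite -mulf_div divff ?mulr1 //; move: aby; rewrite mulf_eq0 negb_or
    => /andP[].
Qed.

Definition gen_space : fspace K := Fspace gen_fspaceP.

End Generated.

(* Final structure along q, as for the quotient by a finite group: a function on
   an open set of T is regular iff it pulls back to a regular function. *)
Definition final_top (K : fieldType) (X : fspace K) (T : choiceType)
  (q : X -> T) : Type := T.

Section Final.
Variables (K : fieldType) (X : fspace K) (T : choiceType) (q : X -> T).

Definition final_open (W : set T) : Prop := open (q @^-1` W).

Lemma final_openT : final_open setT.
Proof. by rewrite /final_open preimage_setT; exact: openT. Qed.

Lemma final_openI : setI_closed final_open.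
Proof. by move=> A B oA oB; rewrite /final_open preimage_setI; exact: openI. Qed.

Lemma final_open_bigU (I : Type) (f : I -> set T) :
  (forall i, final_open (f i)) -> final_open (\bigcup_i f i).
Proof.
move=> of_; rewrite /final_open preimage_bigcup.
by apply: bigcup_open => i _; exact: of_.
Qed.

HB.instance Definition _ := Choice.on (final_top q).
HB.instance Definition _ :=
  isOpenTopological.Build (final_top q) final_openT final_openI final_open_bigU.

Definition final_reg (W : set T) (f : T -> K) : Prop :=
  reg (q @^-1` W) (f \o q).

Lemma final_fspaceP : @is_fspace K (final_top q) final_reg.
Proof.
have [rext rres rglue rcst radd rmul rinv] := fspaceP X; split.
- by move=> U f g fg; apply: rext => x; exact: fg.
- by move=> U V f oV VU; apply: rres => // x; exact: VU.
- move=> U f loc; apply: rglue => x /loc[V [oV Vx VU rf]].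
  by exists (q @^-1` V); split=> // y; exact: VU.
- by move=> U c oU; exact: rcst.
- by move=> U f g oU; exact: radd.
- by move=> U f g oU; exact: rmul.
- by move=> U f oU; exact: rinv.
Qed.

Definition final_space : fspace K := Fspace final_fspaceP.

End Final.

Definition affine_space (K : fieldType) (n : nat) : fspace K :=
  @gen_space K ('I_n -> K) (fun U f => U = setT /\ exists i, f = fun x => x i).

Definition prod_space (K : fieldType) (I : finType) (X : I -> fspace K) :
  fspace K :=
  @gen_space K (forall i, X i) (fun U f => exists i (V : set (X i)) g,
    [/\ open V, reg V g, U = [set x | V (x i)] & f = fun x => g (x i)]).

(* For A locally closed in a variety X, this is the induced reduced structure. *)
Definition sub_space (K : fieldType) (X : fspace K) (A : set X) : fspace K :=
  @gen_space K (set_type A) (fun U f => exists (V : set X) g,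
    [/\ open V, reg V g, U = [set x | V (val x)] & f = fun x => g (val x)]).

Definition sub_incl (K : fieldType) (X : fspace K) (A : set X)
  (p : sub_space A) : X := proj1_sig p.

Definition is_affine (K : fieldType) (X : fspace K) : Prop :=
  exists n (Z : set (affine_space K n)),
    closed Z /\ inhabited (iso X (sub_space Z)).

Definition is_separated (K : fieldType) (X : fspace K) : Prop :=
  closed [set p : prod_space (fun _ : bool => X) | p true = p false].

Definition is_variety (K : fieldType) (X : fspace K) : Prop :=
  is_separated X /\
  exists n (U : 'I_n -> set X),
    [/\ forall i, open (U i), forall i, is_affine (sub_space (U i)) &
        \bigcup_i U i = setT].

Record affine_variety (K : fieldType) := AffineVariety {
  avar :> fspace K;
  avarP : is_affine avar }.

Record variety_over (K : fieldType) (B : fspace K) := VarietyOver {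
  vtot :> fspace K;
  vtotP : is_variety vtot;
  vstr : morph vtot B }.

Record morph_over (K : fieldType) (B : fspace K) (V W : variety_over B) :=
  MorphOver {
  omor :> morph V W;
  omorP : forall p : V, vstr W (omor p) = vstr V p }.

Record affine_functor (K : fieldType) (B : fspace K) := AffineFunctor {
  functor_obj :> affine_variety K -> variety_over B;
  functor_map : forall X Y : affine_variety K,
    morph X Y -> morph_over (functor_obj X) (functor_obj Y);
  functor_map_id : forall (X : affine_variety K) (p : functor_obj X),
    functor_map (morph_id X) p = p;
  functor_map_comp : forall (X Y Z : affine_variety K) (g : morph Y Z)
    (f : morph X Y) (p : functor_obj X),
    functor_map (morph_comp g f) p = functor_map g (functor_map f p) }.

Arguments functor_map [K B] _ [X Y] _.

(* The effective zero-cycle \sum_i m_i [x_i], as its multiplicity function. *)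
Definition zcycle (X : Type) (n : nat) (m : 'I_n -> nat) (x : 'I_n -> X) :
  X -> nat := fun y => (\sum_(i < n) m i * `[< x i = y >])%N.

Definition zcycles (X : Type) (d : nat) : set (X -> nat) :=
  range (@zcycle X d (fun=> 1%N)).

Lemma zcycle_in (X : Type) (d : nat) (x : 'I_d -> X) :
  zcycle (fun=> 1%N) x \in @zcycles X d.
Proof. by apply/mem_set; exists x. Qed.

Definition sym_power (K : fieldType) (d : nat) (X : fspace K) : fspace K :=
  @final_space K (prod_space (fun _ : 'I_d => X)) (set_type (@zcycles X d))
    (fun x => exist _ (zcycle (fun=> 1%N) x) (zcycle_in x)).

Definition multiplicity (K : fieldType) (d : nat) (X : fspace K)
  (c : sym_power d X) : X -> nat := proj1_sig c.

Section Strata.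
Variables (K : fieldType) (k r : nat).

Definition weight_space : fspace K :=
  prod_space (fun _ : 'I_k => affine_space K r).

Definition good_weights : fspace K :=
  @sub_space K weight_space [set m | forall S : {set 'I_k},
    S != finset.set0 -> ~ (forall j : 'I_r, \sum_(i in S) m i j = 0)].

Implicit Types (X : fspace K) (P : 'I_k -> 'I_r -> nat).

Definition sym_power_prod P X : fspace K :=
  prod_space (fun j : 'I_r => sym_power (\sum_(i < k) P i j) X).

Definition is_incidence P X (c : sym_power_prod P X) (x : 'I_k -> X) : Prop :=
  forall j : 'I_r, multiplicity (c j) = zcycle (fun i => P i j) x.

Definition stratum P X : fspace K :=
  sub_space [set c : sym_power_prod P X | exists x, is_incidence c x].

Definition fiber (V : variety_over good_weights) P : fspace K :=
  sub_space [set p : V | forall i j, sub_incl (vstr V p) i j = (P i j)%:R].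

End Strata.

(* Main.v *)
(** Idea. A point of Delta(X) over the weights m is the functional
    f |-> (\sum_i m_i f(x_i)) on functions on X; its structure is the coarsest
    one in which the m_ij and the values on globally regular f are regular, so
    functoriality is push-forward. The chart where chosen coordinates of all
    subset sums m_S are invertible is affine: there every coordinate y of the
    points x_i is integral over the weights and finitely many moments
    p_a = \sum_i m_i y_i^a. Indeed, for |S| = s, the identity
    \sum_(i in S) m_i \prod_(j in S) (y_i - y_j) = 0 expresses m_S y_S^2,
    modulo p_1, ..., p_s, through the monomials y_(S + i), i not in S (where y_S
    is the product of the y_i, i in S), so by descending induction on S all
    y_S are nilpotent modulo the p_a in the associated graded ring; Cayley-
    Hamilton then gives a monic equation. Integrality bounds the moments needed
    as generators and, by lying over, makes the image of X^k closed. That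
    regular functions on X are polynomials is the Nullstellensatz, proved here
    over an uncountable field. The fibre over integral weights is the stratum
    because in characteristic 0 the functions on Sym^d X are generated by power
    sums. *)

Require Import Defs.
From HB Require Import structures.
From mathcomp Require Import all_boot all_order all_algebra.
From mathcomp Require Import boolp classical_sets functions cardinality.
From mathcomp Require Import topology.
From mathcomp Require Import reals complex.
From mathcomp Require Import mpoly.
From mathcomp Require lebesgue_measure.
From mathcomp Require Import ring.

Set Implicit Arguments.
Unset Strict Implicit.
Unset Printing Implicit Defensive.

Import GRing.Theory.
Local Open Scope classical_set_scope.
Local Open Scope ring_scope.

(** * Spaces generated by global functions *)

Section Algebra.
Variables (K : fieldType) (T : Type).
Implicit Types (B : (T -> K) -> Prop) (f g : T -> K).

Inductive alg B : (T -> K) -> Prop :=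
| alg_base f : B f -> alg B f
| alg_cst c : alg B (fun=> c)
| alg_add f g : alg B f -> alg B g -> alg B (fun x => f x + g x)
| alg_mul f g : alg B f -> alg B g -> alg B (fun x => f x * g x).

Lemma alg_ext B f g : f =1 g -> alg B f -> alg B g.
Proof. by move=> /funext ->. Qed.

Lemma alg_opp B f : alg B f -> alg B (fun x => - f x).
Proof.
move=> Bf; apply: (@alg_ext _ (fun x => (-1) * f x)).
  by move=> x; rewrite mulN1r.
by apply: alg_mul => //; exact: alg_cst.
Qed.

Lemma alg_sub B f g : alg B f -> alg B g -> alg B (fun x => f x - g x).
Proof. by move=> Bf Bg; apply: alg_add => //; exact: alg_opp. Qed.

Lemma alg_sum B (I : Type) (s : seq I) (P : pred I) (F : I -> T -> K) :
  (forall i, P i -> alg B (F i)) ->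
  alg B (fun x => \sum_(i <- s | P i) F i x).
Proof.
move=> BF; elim: s => [|i s IH].
  by apply: alg_ext (alg_cst B 0) => x; rewrite big_nil.
case Pi: (P i).
  by apply: alg_ext (alg_add (BF i Pi) IH) => x; rewrite big_cons Pi.
by apply: alg_ext IH => x; rewrite big_cons Pi.
Qed.

Lemma alg_prod B (I : Type) (s : seq I) (P : pred I) (F : I -> T -> K) :
  (forall i, P i -> alg B (F i)) ->
  alg B (fun x => \prod_(i <- s | P i) F i x).
Proof.
move=> BF; elim: s => [|i s IH].
  by apply: alg_ext (alg_cst B 1) => x; rewrite big_nil.
case Pi: (P i).
  by apply: alg_ext (alg_mul (BF i Pi) IH) => x; rewrite big_cons Pi.
by apply: alg_ext IH => x; rewrite big_cons Pi.
Qed.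

Lemma alg_exp B f n : alg B f -> alg B (fun x => f x ^+ n).
Proof.
move=> Bf; elim: n => [|n IH].
  by apply: alg_ext (alg_cst B 1) => x; rewrite expr0.
by apply: alg_ext (alg_mul Bf IH) => x; rewrite exprS.
Qed.

(** The condition [b y != 0 -> W y] makes the locus where [b] is nonzero a principal open
    neighbourhood of [x] inside [W], so the predicate also records that [W] is open. *)
Definition locq B (W : set T) f := forall x, W x -> exists a b,
  [/\ alg B a, alg B b, b x != 0 &
      forall y, b y != 0 -> W y /\ f y = a y / b y].

End Algebra.

(** Lagrange interpolation with separating functions in place of a coordinate. It serves in
    [delta_sep] to replace an arbitrary function by a regular one. *)
Lemma interpolation (K : fieldType) (T : eqType) (B : (T -> K) -> Prop)
    (s : seq T) (v : T -> K) :
  (forall x y, x <> y -> exists2 a, B a & a x != a y) ->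
  exists2 a, alg B a & {in s, a =1 v}.
Proof.
move=> sep.
elim: s => [|y s [a Ba ha]]; first by exists (fun=> 0) => //; exact: alg_cst.
have [ys|ys] := boolP (y \in s).
  by exists a => // x; rewrite inE => /predU1P[->|]; exact: ha.
have [d Bd [dy ds]] : exists2 d, alg B d &
    d y != 0 /\ {in s, forall x, d x = 0}.
  elim: s ys {ha} => [_|z s IH ys].
    by exists (fun=> 1); [exact: alg_cst | split=> //; exact: oner_neq0].
  move: ys; rewrite inE negb_or => /andP[/eqP yz /IH[d Bd [dy ds]]].
  have [b Bb byz] := sep _ _ yz.
  exists (fun x => (b x - b z) * d x).
    apply: alg_mul => //; apply: alg_sub; [exact: alg_base|exact: alg_cst].
  split; first by rewrite mulf_neq0 // subr_eq0.
  move=> x; rewrite inE => /predU1P[->|/ds ->]; last by rewrite mulr0.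
  by rewrite subrr mul0r.
exists (fun x => a x + (v y - a y) / d y * d x).
  by apply: alg_add => //; apply: alg_mul => //; exact: alg_cst.
move=> x; rewrite inE => /predU1P[->|xs]; first by rewrite divfK // addrC subrK.
by rewrite (ds x xs) mulr0 addr0; exact: ha.
Qed.

Lemma alg_comp (K : fieldType) (T T' : Type) (B : (T -> K) -> Prop)
    (B' : (T' -> K) -> Prop) (phi : T' -> T) (f : T -> K) :
  (forall b, B b -> alg B' (b \o phi)) -> alg B f -> alg B' (f \o phi).
Proof.
move=> h; elim=> {f} [f /h //|c|f g _ Bf _ Bg|f g _ Bf _ Bg].
- exact: alg_cst.
- exact: alg_add Bf Bg.
- exact: alg_mul Bf Bg.
Qed.

Lemma alg_trans (K : fieldType) (T : Type) (B B' : (T -> K) -> Prop)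
    (f : T -> K) : (forall b, B b -> alg B' b) -> alg B f -> alg B' f.
Proof. by move=> h /(@alg_comp _ _ _ _ B' id); exact. Qed.

Lemma open_local (T : topologicalType) (W : set T) :
  (forall x, W x -> exists V, [/\ open V, V x & V `<=` W]) -> open W.
Proof.
move=> h; rewrite openE => x /h[V [oV Vx VW]].
by apply: filterS VW _; exact: open_nbhs_nbhs.
Qed.

(** The structure of [X] comes from globally defined functions. The spaces handled below are all
    described this way, and openness, regularity and morphisms are then tested on [B]. *)
Definition genby (K : fieldType) (X : fspace K) (B : (X -> K) -> Prop) :=
  (forall b, B b -> reg setT b) /\
  (forall W f, open W -> reg W f -> locq B W f).

Section Genby.
Variables (K : fieldType) (X : fspace K).
Implicit Types (B : (X -> K) -> Prop).

Lemma reg_alg B a : (forall b, B b -> reg setT b) -> alg B a -> reg setT a.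
Proof.
have [_ _ _ rcst radd rmul _] := fspaceP X.
move=> hB; elim=> {a} [f /hB //|c|f g _ Bf _ Bg|f g _ Bf _ Bg].
- by apply: rcst; exact: openT.
- by apply: radd => //; exact: openT.
- by apply: rmul => //; exact: openT.
Qed.

Lemma open_neq0 (b : X -> K) : reg setT b -> open [set x | b x != 0].
Proof.
have [_ _ _ _ _ _ rinv] := fspaceP X.
by move=> /(rinv _ _ openT)[]; rewrite setTI.
Qed.

Lemma genby_open B W x : genby B -> open W -> W x ->
  exists b, [/\ alg B b, b x != 0 & forall y, b y != 0 -> W y].
Proof.
have [_ _ _ rcst _ _ _] := fspaceP X.
move=> [_ h] oW Wx; have [a [b [_ Bb bx hb]]] := h _ _ oW (rcst W 0 oW) _ Wx.
by exists b; split=> // y /hb[].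
Qed.

Lemma locq_reg B W f : (forall b, B b -> reg setT b) -> locq B W f -> reg W f.
Proof.
have [rext rres rglue rcst radd rmul rinv] := fspaceP X.
move=> hB lW; apply: rglue => x /lW[a [b [Ba Bb bx hb]]].
have rb := reg_alg hB Bb; have ob := open_neq0 rb.
exists [set x | b x != 0]; split=> //; first by move=> y /hb[].
apply: (rext _ (fun x => a x * (b x)^-1)) => [y /hb[_ ->] //|].
apply: rmul => //; first by apply: rres (reg_alg hB Ba) => //.
by have [_] := rinv _ _ openT rb; rewrite setTI.
Qed.

Lemma genby_trans B B' : genby B -> (forall b, B b -> alg B' b) ->
  (forall b, B' b -> reg setT b) -> genby B'.
Proof.
move=> [_ h] BB' hB'; split=> // W f oW rf x Wx.
have [a [b [Ba Bb bx hb]]] := h _ _ oW rf _ Wx.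
by exists a, b; split=> //; apply: alg_trans BB' _.
Qed.

End Genby.

Lemma morph_genby (K : fieldType) (X Y : fspace K) (B : (Y -> K) -> Prop)
    (f : X -> Y) :
  genby B -> (forall b, B b -> reg setT (b \o f)) -> is_morph f.
Proof.
move=> gB hf; have [_ lB] := gB.
have [rext rres rglue rcst radd rmul rinv] := fspaceP X.
have hf' a : alg B a -> reg setT (a \o f).
  move=> /(@alg_comp _ _ _ _ (fun h : X -> K => reg setT h) f) Ba.
  by apply: (reg_alg (B := fun h : X -> K => reg setT h)) => //;
     apply: Ba => b /hf; exact: alg_base.
have of_ W : open W -> open (f @^-1` W).
  move=> oW; apply: open_local => x Wfx.
  have [b [Bb bx hb]] := genby_open gB oW Wfx.
  exists [set x | b (f x) != 0]; split=> //; last by move=> y /hb.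
  exact: open_neq0 (hf' _ Bb).
split; first by apply/continuousP.
move=> W g oW rg; apply: rglue => x Wfx.
have [a [b [Ba Bb bx hb]]] := lB _ _ oW rg _ Wfx.
have rb := hf' _ Bb; have ob := open_neq0 rb.
exists [set x | b (f x) != 0]; split=> //; first by move=> y /hb[].
apply: (rext _ (fun x => a (f x) * (b (f x))^-1)) => [y /hb[_ /= ->] //|].
apply: rmul => //; first by apply: rres (hf' _ Ba) => //.
by have [_] := rinv _ _ openT rb; rewrite setTI.
Qed.

Lemma iso_genby (K : fieldType) (X Y : fspace K) (B : (X -> K) -> Prop)
    (B' : (Y -> K) -> Prop) (f : X -> Y) (g : Y -> X) :
  genby B -> genby B' -> cancel f g -> cancel g f ->
  (forall b, B' b -> reg setT (b \o f)) ->
  (forall b, B b -> reg setT (b \o g)) ->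
  exists e : iso X Y, iso_fwd e = f :> (X -> Y).
Proof.
move=> gB gB' fK gK hf hg.
by exists (@Iso _ X Y (Morph (morph_genby gB' hf)) (Morph (morph_genby gB hg))
  fK gK).
Qed.

Lemma iso_genby_transport (K : fieldType) (X Y : fspace K) (e : iso X Y)
    (B : (Y -> K) -> Prop) (B' : (X -> K) -> Prop) :
  genby B -> (forall b, B b -> B' (b \o e)) ->
  (forall b, B' b -> reg setT b) -> genby B'.
Proof.
move=> [hB lB] BB' hB'; split=> // W f oW rf x Wx.
have [cbwd rbwd] := morphP (iso_bwd e).
have oV : open (iso_bwd e @^-1` W) by move/continuousP: cbwd; apply.
have Vx : (iso_bwd e @^-1` W) (e x) by rewrite /preimage /= iso_fwdK.
have [a [b [Ba Bb bx hb]]] := lB _ _ oV (rbwd _ _ oW rf) _ Vx.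
have h a' : alg B a' -> alg B' (a' \o e).
  by apply: alg_comp => b' /BB'; exact: alg_base.
exists (a \o e), (b \o e); split=> //; [exact: h|exact: h|].
by move=> y /hb; rewrite /= /preimage /= iso_fwdK.
Qed.

Section GenSpace.
Variables (K : fieldType) (T : choiceType).
Variables (base : set T -> (T -> K) -> Prop) (B : (T -> K) -> Prop).

Lemma gen_space_genby :
  (forall b, B b -> base setT b) ->
  (forall U f, base U f -> locq B U f) ->
  genby (X := gen_space base) B.
Proof.
move=> hB hbase; split.
  move=> b /hB bb x _; exists setT, b, (fun=> 1); split=> //.
  - exact: gen_base.
  - exact: gen_cst.
  - exact: oner_neq0.
  - by move=> y _ _; rewrite divr1.
have lgen U f : gen_loc base U f -> locq B U f.
  elim=> {U f} [U f /hbase //|c|U V f g _ lf _ lg|U V f g _ lf _ lg].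
  - move=> x _; exists (fun=> c), (fun=> 1); split=> //.
    + exact: alg_cst.
    + exact: alg_cst.
    + exact: oner_neq0.
    + by move=> y _; rewrite divr1.
  - move=> x [/lf[a [b [Ba Bb bx hb]]] /lg[c [d [Bc Bd dx hd]]]].
    exists (fun x => a x * d x + c x * b x), (fun x => b x * d x).
    split; [|exact: alg_mul|exact: mulf_neq0|].
      by apply: alg_add; exact: alg_mul.
    move=> y; rewrite mulf_eq0 negb_or => /andP[by0 dy0].
    have [Uy ->] := hb _ by0; have [Vy ->] := hd _ dy0.
    by rewrite addf_div.
  - move=> x [/lf[a [b [Ba Bb bx hb]]] /lg[c [d [Bc Bd dx hd]]]].
    exists (fun x => a x * c x), (fun x => b x * d x).
    split; [exact: alg_mul|exact: alg_mul|exact: mulf_neq0|].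
    move=> y; rewrite mulf_eq0 negb_or => /andP[by0 dy0].
    have [Uy ->] := hb _ by0; have [Vy ->] := hd _ dy0.
    by rewrite mulf_div.
move=> W f _ rf x /rf[U [g [h [lg lh Ux hx hf]]]].
have [a [b [Ba Bb bx hb]]] := lgen _ _ lg _ Ux.
have [c [d [Bc Bd dx hd]]] := lgen _ _ lh _ Ux.
have cx : c x != 0.
  by apply: contra_neq hx => cx; have [_ ->] := hd _ dx; rewrite cx mul0r.
(* Here [g / h = (a / b) / (c / d)]; the fraction is expanded by a further [d / d] so that a nonzero
   denominator also forces [d] to be nonzero. *)
exists (fun x => a x * d x * d x), (fun x => b x * c x * d x); split.
- by do 2?apply: alg_mul.
- by do 2?apply: alg_mul.
- by rewrite !mulf_neq0.
move=> y; rewrite !mulf_eq0 !negb_or => /andP[/andP[by0 cy0] dy0].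
have [Uy gE] := hb _ by0; have [_ hE] := hd _ dy0.
have [|Wy ->] := hf y Uy; first by rewrite hE mulf_neq0 // invr_neq0.
split=> //; rewrite gE hE.
by field; rewrite by0 cy0 dy0.
Qed.

End GenSpace.

Lemma affine_space_genby (K : fieldType) n :
  genby (X := affine_space K n) (fun f => exists i, f = fun x => x i).
Proof.
apply: gen_space_genby => [b hb|U f [-> hf]]; first by split.
move=> x _; exists f, (fun=> 1); split; [exact: alg_base|exact: alg_cst| |].
  exact: oner_neq0.
by move=> y _; rewrite divr1.
Qed.

Lemma prod_genby (K : fieldType) (I : finType) (X : I -> fspace K)
    (B : forall i, (X i -> K) -> Prop) :
  (forall i, genby (B i)) ->
  genby (X := prod_space X)
    (fun f => exists i b, B i b /\ f = fun x => b (x i)).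
Proof.
move=> gB; apply: gen_space_genby.
  move=> _ [i [b [Bb ->]]]; exists i, setT, b; split=> //; first exact: openT.
  by have [h _] := gB i; exact: h.
move=> _ _ [i [V [g [oV rg -> ->]]]] x Vx.
have [_ lB] := gB i; have [a [b [Ba Bb bx hb]]] := lB _ _ oV rg _ Vx.
have h c : alg (B i) c ->
    alg (fun f => exists i b, B i b /\ f = fun x => b (x i))
      (fun x : forall i, X i => c (x i)).
  apply: (alg_comp (phi := fun x : forall i, X i => x i)) => b' Bb'.
  by apply: alg_base; exists i, b'.
exists (fun x => a (x i)), (fun x => b (x i)).
by split=> [||//|y /hb]; [exact: h|exact: h|].
Qed.

Lemma sub_genby (K : fieldType) (X : fspace K) (A : set X)
    (B : (X -> K) -> Prop) :
  genby B -> genby (X := sub_space A) (fun f => exists b, B b /\ f = b \o val).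
Proof.
move=> [hB lB]; apply: gen_space_genby.
  move=> _ [b [Bb ->]]; exists setT, b; split=> //; first exact: openT.
  exact: hB.
move=> _ _ [V [g [oV rg -> ->]]] x Vx.
have [a [b [Ba Bb bx hb]]] := lB _ _ oV rg _ Vx.
have h c : alg B c -> alg (fun f => exists b, B b /\ f = b \o val)
    (fun x : sub_space A => c (val x)).
  apply: (alg_comp (phi := fun x : sub_space A => val x)) => b' Bb'.
  by apply: alg_base; exists b'.
exists (fun x => a (val x)), (fun x => b (val x)).
by split; [exact: h|exact: h|exact: bx|move=> y; exact: hb].
Qed.

Arguments sub_genby [K X] A [B] _.

(** * The Nullstellensatz *)

(** The form in which uncountability enters: some fibre of [N] is infinite, so [m] can be fixed
    before the number [d] of elements is chosen. *)
Definition pigeonhole (T : eqType) := forall N : T -> nat, exists m, forall d,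
  exists s : seq T, [/\ uniq s, size s = d & forall c, c \in s -> N c = m].

(** Were all fibres finite on the real line, the reals would be countable, against the length 1 of
    the unit interval. *)
Lemma complex_pigeonhole (R : realType) : pigeonhole R[i].
Proof.
move=> N.
pose A m := [set x : R | N (x%:C)%C = m].
have [m infA] : exists m, infinite_set (A m).
  apply: contrapT => /forallNP finA.
  have cA : countable (\bigcup_(m in setT) A m).
    apply: bigcup_countable => [|m _]; first exact: countableP.
    by apply: finite_set_countable; apply: contrapT; exact: finA.
  have /lebesgue_measure.countable_lebesgue_measure0 : countable [set` `[0 : R, 1]].
    by apply: sub_countable cA; apply: subset_card_le => x _; exists (N (x%:C)%C).
  rewrite lebesgue_measure.lebesgue_measure_itv /=.
  rewrite constructive_ereal.lte_fin Num.Theory.ltr01.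
  rewrite -constructive_ereal.EFinB subr0 => -[] /eqP.
  by rewrite oner_eq0.
exists m => d; have [B BA dB] := infinite_set_fset d infA.
exists (take d [seq (x%:C)%C | x <- finmap.enum_fset B]); split.
- rewrite take_uniq // map_inj_uniq ?finmap.fset_uniq //.
  by move=> x y [].
- by rewrite size_take size_map; case: ltngtP dB.
- by move=> c /mem_take /mapP[x xB ->]; exact: (BA x).
Qed.

(** * Filtration by degree in given functions *)

Section Filtration.
Variables (K : fieldType) (E : Type) (k : nat).
Variables (C : (E -> K) -> Prop) (y : 'I_k -> E -> K).

(** The coefficients [C] are a parameter: constants for the degree bounds in the Nullstellensatz,
    functions coming from a base ring for integrality. *)
Inductive filt : nat -> (E -> K) -> Prop :=
| filt_mon d c (b : 'I_k -> nat) : C c -> (\sum_i b i <= d)%N ->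
    filt d (fun e => c e * \prod_i y i e ^+ b i)
| filt_add d f g : filt d f -> filt d g -> filt d (fun e => f e + g e).

Lemma filt_ext d f g : f =1 g -> filt d f -> filt d g.
Proof. by move=> /funext ->. Qed.

Lemma filt_le d d' f : (d <= d')%N -> filt d f -> filt d' f.
Proof.
move=> + h; elim: h => {d f} [d c b Cc bd dd'|d f g _ Ff _ Fg dd'].
  by apply: filt_mon => //; exact: leq_trans dd'.
by apply: filt_add; [exact: Ff|exact: Fg].
Qed.

Lemma filt_cst d c : C c -> filt d c.
Proof.
move=> Cc; apply: filt_ext (@filt_mon d c (fun=> 0%N) Cc _).
  by move=> e; rewrite big1 ?mulr1 // => i _; rewrite expr0.
by rewrite big1.
Qed.

Hypothesis C1 : C (fun=> 1).

Lemma filt_var i : filt 1 (y i).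
Proof.
apply: filt_ext (@filt_mon 1 _ (fun l => (l == i) : nat) C1 _).
  move=> e; rewrite mul1r (bigD1 i) //= eqxx expr1 big1 ?mulr1 //.
  by move=> l /negbTE ->; rewrite expr0.
by rewrite (bigD1 i) //= eqxx big1 // => l /negbTE ->.
Qed.

Hypothesis C0 : C (fun=> 0).
Hypothesis CD : forall f g, C f -> C g -> C (fun e => f e + g e).

(** Like monomials are collected. The finite list of monomials depends only on [d], as both the
    linear-dependence argument and the determinant trick require. *)
Lemma filt_normal d f : filt d f ->
  exists2 l : {ffun 'I_k -> 'I_d.+1} -> E -> K, (forall b, C (l b)) &
    forall e, f e = \sum_b l b e * \prod_i y i e ^+ b i.
Proof.
elim=> {d f} [d c b Cc bd|d f g _ [l Cl fE] _ [m Cm gE]].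
  pose b' : {ffun 'I_k -> 'I_d.+1} := [ffun i => inord (b i)].
  have b'E i : b' i = b i :> nat.
    rewrite ffunE inordK // ltnS; apply: leq_trans bd.
    by rewrite (bigD1 i) //= leq_addr.
  exists (fun b0 => if b0 == b' then c else fun=> 0) => [b0|e].
    by case: ifP.
  rewrite (bigD1 b') //= eqxx [X in _ + X]big1 ?addr0.
    by under eq_bigr do rewrite -b'E.
  by move=> b0 /negbTE ->; rewrite mul0r.
exists (fun b e => l b e + m b e) => [b|e]; first exact: CD.
by rewrite fE gE -big_split /=; apply: eq_bigr => b _; rewrite mulrDl.
Qed.

End Filtration.

Section FiltMul.
Variables (K : fieldType) (E : Type) (k : nat) (y : 'I_k -> E -> K).
Variables (C C' D : (E -> K) -> Prop).
Hypothesis CM : forall f g, C f -> C' g -> D (fun e => f e * g e).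

Lemma filt_mul d d' f g :
  filt C y d f -> filt C' y d' g -> filt D y (d + d') (fun e => f e * g e).
Proof.
move=> h; elim: h g => {d f} [d c b Cc bd|d f f' _ Ff _ Ff'] g hg.
  elim: hg => {d' g} [d' c' b' Cc' bd'|d' g g' _ Fg _ Fg'].
    apply: filt_ext (@filt_mon _ _ _ _ _ (d + d') _ (fun i => b i + b' i)%N
      (CM Cc Cc') _).
      move=> e; rewrite mulrACA; congr (_ * _).
      by rewrite -big_split; apply: eq_bigr => i _; rewrite exprD.
    by rewrite big_split leq_add.
  by apply: filt_ext (filt_add Fg Fg') => e; rewrite mulrDr.
by apply: filt_ext (filt_add (Ff _ hg) (Ff' _ hg)) => e; rewrite mulrDl.
Qed.

End FiltMul.

Definition coords (K : fieldType) (T I : Type) (xi : I -> T -> K)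
  (f : T -> K) := exists i, f = xi i.

Lemma alg_filt (K : fieldType) (T : Type) n (xi : 'I_n -> T -> K) f :
  alg (coords xi) f ->
  exists d, filt (fun c : T -> K => exists a, c = fun=> a) xi d f.
Proof.
elim=> {f} [_ [i ->]|c|f g _ [d Ff] _ [d' Fg]|f g _ [d Ff] _ [d' Fg]].
- by exists 1%N; apply: filt_var; exists 1.
- by exists 0%N; apply: filt_cst; exists c.
- exists (maxn d d').
  by apply: filt_add; [apply: filt_le Ff|apply: filt_le Fg];
    rewrite ?leq_maxl ?leq_maxr.
- exists (d + d')%N; apply: filt_mul Ff Fg.
  by move=> _ _ [a ->] [b ->]; exists (a * b).
Qed.

(** * Maximal ideals and their zeros *)

Section Nullstellensatz.
Variables (K : closedFieldType) (n : nat).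
Hypothesis pigeonK : pigeonhole K.

Notation X := (fun i (v : 'I_n -> K) => v i).
Notation P := (alg (coords X)).

Definition is_ideal (I : set (('I_n -> K) -> K)) := [/\ I `<=` P, I (fun=> 0),
  forall f g, I f -> I g -> I (fun v => f v + g v) &
  forall f g, P f -> I g -> I (fun v => f v * g v)].

Lemma maximal_ideal I : is_ideal I -> ~ I (fun=> 1) ->
  exists M, [/\ is_ideal M, I `<=` M, ~ M (fun=> 1) &
    forall a, P a -> ~ M a -> exists2 g, P g & M (fun v => 1 - a v * g v)].
Proof.
move=> idI I1.
pose Q A := A = set0 \/ [/\ is_ideal A, I `<=` A & ~ A (fun=> 1)].
have [F FQ tF|M [QM maxM]] := @Zorn_bigcup _ Q.
  have [[A FA [a Aa]]|h] := pselect (exists2 A, F A & A !=set0); last first.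
    left; rewrite -subset0 => a [A FA Aa]; apply: h.
    by exists A => //; exists a.
  right; have FI B b : F B -> B b -> [/\ is_ideal B, I `<=` B & ~ B (fun=> 1)].
    by move=> /FQ[->|//].
  split; last 2 first.
  - have [_ IA _] := FI _ _ FA Aa; move=> f If; exists A => //; exact: IA.
  - by move=> [B FB B1]; have [_ _] := FI _ _ FB B1; exact.
  split.
  - by move=> b [B FB Bb]; have [[BP _ _ _] _ _] := FI _ _ FB Bb; exact: BP.
  - by exists A => //; have [[_ ? _ _] _ _] := FI _ _ FA Aa.
  - move=> f g [B FB Bf] [B' FB' Bg].
    have [[_ _ BD _] _ _] := FI _ _ FB Bf.
    have [[_ _ BD' _] _ _] := FI _ _ FB' Bg.
    have [BB'|B'B] := tF _ _ FB FB'.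
      by exists B' => //; apply: BD' => //; exact: BB'.
    by exists B => //; apply: BD => //; exact: B'B.
  - move=> f g Pf [B FB Bg]; exists B => //.
    by have [[_ _ _ BM] _ _] := FI _ _ FB Bg; exact: BM.
have [I0 ID IM] : [/\ I (fun=> 0), forall f g, I f -> I g ->
    I (fun v => f v + g v) & forall f g, P f -> I g -> I (fun v => f v * g v)].
  by case: idI.
have [idM IM' M1] : [/\ is_ideal M, I `<=` M & ~ M (fun=> 1)].
  case: QM => // M0; exfalso; apply: (maxM I); last by right; split=> // f.
  by rewrite M0 properEneq; split=> //; apply/eqP => I0'; move: I0; rewrite -I0'.
exists M; split=> // a Pa Ma.
have [MP M0 MD MM] := idM.
pose M' := [set f | exists m g, [/\ M m, P g & f = fun v => m v + a v * g v]].
have MM' : M `<` M'.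
  split.
    move=> f Mf; exists f, (fun=> 0); split=> //; first exact: alg_cst.
    by apply/funext => v; rewrite mulr0 addr0.
  move=> /(_ a); apply: contra_not Ma => /(_ _); apply.
  exists (fun=> 0), (fun=> 1); split=> //; first exact: alg_cst.
  by apply/funext => v; rewrite mulr1 add0r.
have /not_orP[_ nM'] := maxM _ MM'.
have [m [g [Mm Pg e1]]] : M' (fun=> 1).
  apply: contrapT => M'1; apply: nM'; split=> //; last first.
    by move=> f /IM' /MM'.1.
  split.
  - move=> _ [m [g [Mm Pg ->]]]; apply: alg_add; first exact: MP.
    exact: alg_mul.
  - exact: MM'.1.
  - move=> _ _ [m [g [Mm Pg ->]]] [m' [g' [Mm' Pg' ->]]].
    exists (fun v => m v + m' v), (fun v => g v + g' v); split.
    + exact: MD.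
    + exact: alg_add.
    + by apply/funext => v; rewrite mulrDr addrACA.
  - move=> f _ Pf [m [g [Mm Pg ->]]].
    exists (fun v => f v * m v), (fun v => f v * g v); split.
    + exact: MM.
    + exact: alg_mul.
    + by apply/funext => v; rewrite mulrDr mulrCA.
exists g => //; suff -> : (fun v => 1 - a v * g v) = m by [].
by apply/funext => v; have /(congr1 (@^~ v)) /= -> := e1; rewrite addrK.
Qed.

(* The inverses of the [x_l - c] modulo a maximal ideal, for uncountably many
   [c], would lie in a countable union of finite-dimensional spaces. *)
Lemma weak_nullstellensatz I : is_ideal I -> ~ I (fun=> 1) ->
  exists v, forall f, I f -> f v = 0.
Proof.
move=> idI /(maximal_ideal idI)[M [[MP M0 MD MM] IM M1 maxM]].
have Mcst c : M (fun=> c) -> c = 0.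
  move=> Mc; apply: contrapT => /eqP c0; apply: M1.
  have := MM _ _ (alg_cst _ c^-1) Mc.
  by congr (M _); apply/funext => v; rewrite mulVf.
have Mprime a b : P a -> P b -> M (fun v => a v * b v) -> M a \/ M b.
  move=> Pa Pb Mab; have [Ma|nMa] := pselect (M a); [by left|right].
  have [g Pg Mg] := maxM _ Pa nMa.
  have := MD _ _ (MM _ _ Pb Mg) (MM _ _ Pg Mab).
  by congr (M _); apply/funext => v; ring.
have Msum (J : Type) (s : seq J) (F : J -> ('I_n -> K) -> K) :
    (forall j, M (F j)) -> M (fun v => \sum_(j <- s) F j v).
  move=> MF; elim: s => [|j s IH].
    by move: M0; congr (M _); apply/funext => v; rewrite big_nil.
  by have := MD _ _ (MF j) IH; congr (M _); apply/funext => v; rewrite big_cons.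
have PX l c : P (fun v => v l - c).
  by apply: alg_sub; [apply: alg_base; exists l|exact: alg_cst].
have Ppoly (F : {poly K}) l : P (fun v => F.[v l]).
  apply: (@alg_ext _ _ _ (fun v => \sum_(i < size F) F`_i * v l ^+ i)).
    by move=> v; rewrite horner_coef.
  apply: alg_sum => i _; apply: alg_mul; first exact: alg_cst.
  by apply: alg_exp; apply: alg_base; exists l.
(* [F] splits into linear factors over the closed field, and the maximal ideal [M] is prime, so some
   factor lies in [M]. *)
have root_M l (F : {poly K}) : F != 0 -> M (fun v => F.[v l]) ->
    exists c, M (fun v => v l - c).
  have [r ->] := closed_field_poly_normal F.
  rewrite scaler_eq0 negb_or => /andP[lF _].
  have {}lF : lead_coef F != 0 by [].
  elim: r => [|c r IH].
    rewrite big_nil => h; exfalso; move/eqP: lF; apply; apply: Mcst.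
    by move: h; congr (M _); apply/funext => v; rewrite hornerZ hornerC mulr1.
  rewrite big_cons => h.
  have [||||/IH //] := @Mprime (fun v => v l - c)
    (fun v => (lead_coef F *: \prod_(z <- r) ('X - z%:P)).[v l]).
  - exact: PX.
  - exact: Ppoly.
  - move: h; congr (M _); apply/funext => v.
    by rewrite !hornerZ hornerM hornerXsubC mulrCA.
  - by move=> Mc; exists c.
have key l : exists c, M (fun v => v l - c).
  apply: contrapT => /forallNP nM.
  have /choice[g hg] c : exists g, P g /\ M (fun v => 1 - (v l - c) * g v).
    by have [g] := maxM _ (PX l c) (nM c); exists g.
  have /choice[N hN] c := alg_filt (hg c).1.
  (* [g c] inverts [x_l - c] modulo [M], and [N c] bounds its degree. Taking more [c] with the same
     bound [m] than there are monomials with exponents at most [m] makes the functions [g c]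
     linearly dependent. *)
  have [m hm] := pigeonK N.
  pose B := {ffun 'I_n -> 'I_m.+1}.
  have [s [us ss sN]] := hm #|B|.+1.
  have s_in (t : 'I_#|B|.+1) : s`_t \in s by rewrite mem_nth // ss.
  have /choice[lam hlam] (t : 'I_#|B|.+1) : exists lam : B -> K,
      forall v, g s`_t v = \sum_b lam b * \prod_i v i ^+ b i.
    have := hN s`_t; rewrite (sN _ (s_in t)) => Fg.
    have [||L /choice[a La] gE] := filt_normal _ _ Fg.
    + by exists 0.
    + by move=> _ _ [a ->] [b ->]; exists (a + b).
    + exists a => v.
      by rewrite gE; apply: eq_bigr => b _; rewrite La.
  pose A : 'M[K]_(#|B|.+1, #|B|) := \matrix_(t, b) lam t (enum_val b).
  have [u uA u0] : exists2 u : 'rV_#|B|.+1, u *m A = 0 & u != 0.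
    have : kermx A != 0.
      rewrite kermx_eq0 -row_leq_rank -ltnNge.
      exact: leq_ltn_trans (rank_leq_col A) _.
    move=> /rowV0Pn[u /sub_kermxP uA u0]; by exists u.
  have ug v : \sum_t u 0 t * g s`_t v = 0.
    under eq_bigr do rewrite hlam mulr_sumr.
    rewrite exchange_big big1 //= => b _.
    under eq_bigr do rewrite mulrA.
    rewrite -mulr_suml; suff -> : \sum_t u 0 t * lam t b = 0 by rewrite mul0r.
    have /rowP/(_ (enum_rank b)) := uA; rewrite !mxE => {2}<-.
    by apply: eq_bigr => t _; rewrite mxE enum_rankK.
  (* The relation [\sum_t u_t / (X - s_t) = 0] with denominators cleared. Its value at [s_t] is
     [u_t] times a nonzero product, and some [u_t] is nonzero. *)
  pose F : {poly K} :=
    \sum_t u 0 t *: \prod_(t' | t' != t) ('X - (s`_t')%:P).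
  have [||c] := root_M l F; last exact: nM.
    have [t ut] : exists t, u 0 t != 0.
      apply: contrapT => /forallNP h; move/eqP: u0; apply; apply/rowP => t.
      by rewrite mxE; apply/eqP; apply: contrapT => /negP; exact: h.
    apply: contra_neq ut => /(congr1 (fun p : {poly K} => p.[s`_t])).
    rewrite horner0 horner_sum (bigD1 t) //= [X in _ + X]big1 ?addr0.
      rewrite hornerZ horner_prod => /eqP.
      rewrite mulf_eq0 => /orP[/eqP //|/prodf_eq0[t' t't]].
      rewrite hornerXsubC subr_eq0 nth_uniq ?ss //.
      by move=> /eqP /val_inj tt'; rewrite tt' eqxx in t't.
    move=> t' t't; rewrite hornerZ horner_prod (bigD1 t) 1?eq_sym //=.
    by rewrite hornerXsubC subrr mul0r mulr0.
  suff : M (fun v => \sum_(t < #|B|.+1) u 0 t *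
      (\prod_(t' | t' != t) (v l - s`_t') * (1 - (v l - s`_t) * g s`_t v))).
    congr (M _); apply/funext => v; rewrite horner_sum.
    transitivity (\sum_(t < #|B|.+1) (u 0 t * \prod_(t' | t' != t) (v l - s`_t')) -
        (\prod_(t < #|B|.+1) (v l - s`_t)) *
        \sum_(t < #|B|.+1) u 0 t * g s`_t v).
      rewrite mulr_sumr -sumrB; apply: eq_bigr => t _.
      by rewrite [\prod_(t' < #|B|.+1) (v l - s`_t')](bigD1 t) //=; ring.
    rewrite ug mulr0 subr0; apply: eq_bigr => t _.
    rewrite hornerZ horner_prod; congr (_ * _); apply: eq_bigr => t' _.
    by rewrite hornerXsubC.
  apply: (Msum _ _ (fun (t : 'I_#|B|.+1) v => u 0 t * (\prod_(t' | t' != t) (v l - s`_t') *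
    (1 - (v l - s`_t) * g s`_t v)))) => t.
  apply: (MM (fun=> u 0 t)); first exact: alg_cst.
  apply: (MM (fun v => \prod_(t' | t' != t) (v l - s`_t'))); last exact: (hg _).2.
  by apply: alg_prod => t' _; exact: PX.
have [c hc] := choice key.
exists c => f /IM Mf.
have : M (fun v => f v - f c).
  elim: (MP _ Mf) => {f Mf} [_ [l ->] //|a|f g Pf Mf _ Mg|f g Pf Mf Pg Mg].
  - by move: M0; congr (M _); apply/funext => v; rewrite subrr.
  - by have := MD _ _ Mf Mg; congr (M _); apply/funext => v; ring.
  - have := MD _ _ (MM _ _ Pg Mf) (MM _ _ (alg_cst _ (f c)) Mg).
    by congr (M _); apply/funext => v; ring.
move=> /(MM _ _ (alg_cst _ (-1)))/(MD _ _ Mf) h; apply: Mcst.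
by move: h; congr (M _); apply/funext => v; ring.
Qed.

End Nullstellensatz.

(** * Closed embeddings into affine space *)

Section Chart.
Variables (K : fieldType) (X : fspace K).

Definition chart n (xi : 'I_n -> X -> K) :=
  [/\ genby (coords xi), forall x y, x <> y -> exists i, xi i x != xi i y &
      closed ([set v | exists x, forall i, v i = xi i x]
        : set (affine_space K n))].

Lemma affine_chart : is_affine X -> exists n (xi : 'I_n -> X -> K), chart xi.
Proof.
move=> [n [Z [cZ [e]]]].
have gZ := sub_genby Z (affine_space_genby K n).
have hxi i : reg setT (fun x : X => val (e x) i).
  have [_ re] := morphP e; have [hB _] := gZ.
  apply: (re setT (fun z => val z i)); first exact: openT.
  by apply: hB; exists (fun z : 'I_n -> K => z i); split=> //; exists i.
exists n, (fun i x => val (e x) i); split.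
- apply: iso_genby_transport gZ _ _; last by move=> _ [i ->].
  by move=> _ [_ [[i ->] ->]]; exists i.
- move=> x y xy; apply: contrapT => /forallNP h; apply: xy.
  rewrite -(iso_fwdK e x) -(iso_fwdK e y); congr (iso_bwd e _).
  apply: val_inj; apply/funext => i; apply/eqP; apply: contrapT => /negP.
  exact: h.
- rewrite (_ : [set v | _] = Z) //; apply/seteqP; split=> v /=.
    move=> [x vE]; rewrite (_ : v = val (e x)); last exact/funext.
    by apply/set_mem; case: (e x).
  move=> Zv; exists (iso_bwd e (exist _ v (mem_set Zv))) => i.
  by rewrite iso_bwdK.
Qed.

Lemma chart_affine n (xi : 'I_n -> X -> K) : chart xi -> is_affine X.
Proof.
move=> [gX sep cZ].
pose Z : set (affine_space K n) := [set v | exists x, forall i, v i = xi i x].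
exists n, Z; split=> //.
have gZ := sub_genby Z (affine_space_genby K n).
pose f (x : X) : sub_space Z :=
  exist _ (fun i => xi i x) (mem_set (ex_intro _ x (fun=> erefl)) : _ \in Z).
have /choice[g hg] (z : sub_space Z) : exists x, forall i, val z i = xi i x.
  exact: set_mem (valP z).
have fK : cancel f g.
  move=> x; apply: contrapT => h; have [l] := sep _ _ h.
  by rewrite -hg eqxx.
have gK : cancel g f.
  by move=> z; apply: val_inj; apply/funext => i; rewrite [RHS]hg.
have [||e _] := iso_genby gX gZ fK gK; last exact: (inhabits e).
- by move=> _ [_ [[i ->] ->]]; have [h _] := gX; apply: h; exists i.
- move=> _ [i ->]; rewrite (_ : xi i \o g = fun z : sub_space Z => val z i).
    have [h _] := gZ; apply: h; exists (fun z : 'I_n -> K => z i).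
    by split=> //; exists i.
  by apply/funext => z; rewrite hg.
Qed.

End Chart.

Lemma coords_lift (K : fieldType) (T I : Type) (xi : I -> T -> K) f :
  alg (coords xi) f -> exists2 g, alg (coords (fun i (v : I -> K) => v i)) g &
    forall x, f x = g (fun i => xi i x).
Proof.
elim=> {f} [_ [i ->]|c|f f' _ [g Pg fE] _ [g' Pg' fE']
                      |f f' _ [g Pg fE] _ [g' Pg' fE']].
- by exists (fun v => v i) => //; apply: alg_base; exists i.
- by exists (fun=> c) => //; exact: alg_cst.
- by exists (fun v => g v + g' v) => [|x]; [exact: alg_add|rewrite fE fE'].
- by exists (fun v => g v * g' v) => [|x]; [exact: alg_mul|rewrite fE fE'].
Qed.

Lemma closed_separated (K : fieldType) n (Z : set (affine_space K n)) v :
  closed Z -> ~ Z v -> exists h,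
    [/\ alg (coords (fun i (v : 'I_n -> K) => v i)) h, h v != 0 &
        forall w, Z w -> h w = 0].
Proof.
move=> /closed_openC oZ nZv.
have [h [Ph hv hZ]] := genby_open (affine_space_genby K n) oZ nZv.
exists h; split=> // w Zw; apply/eqP; apply: contrapT => /negP /hZ; exact.
Qed.

(** The polynomials [v] for which [v * a] is polynomial on [X] form an ideal of denominators. It has
    no common zero: off [X] some equation of [X], itself in the ideal, is nonzero, and on [X] a
    local denominator of [a] gives an element that is nonzero there. Hence 1 is a denominator. *)
Lemma chart_reg (K : closedFieldType) (X : fspace K) n (xi : 'I_n -> X -> K)
    (a : X -> K) :
  pigeonhole K -> chart xi -> reg setT a -> alg (coords xi) a.
Proof.
move=> pigeonK [gX sep cZ] ra.
pose P := alg (coords (fun i (v : 'I_n -> K) => v i)).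
pose ev x i := xi i x.
pose I : set (('I_n -> K) -> K) := [set v | P v /\ exists2 u, P u &
  forall x, v (ev x) * a x = u (ev x)].
have [[_ [u Pu uE]]|I1] := pselect (I (fun=> 1)).
  apply: (@alg_ext _ _ _ (u \o ev)) => [x|]; first by rewrite /= -uE mul1r.
  by apply: alg_comp Pu => _ [i ->]; apply: alg_base; exists i.
have idI : is_ideal I.
  split.
  - by move=> f [].
  - split; first exact: alg_cst.
    by exists (fun=> 0) => [|x]; [exact: alg_cst|rewrite mul0r].
  - move=> f g [Pf [u Pu fE]] [Pg [w Pw gE]]; split; first exact: alg_add.
    exists (fun v => u v + w v) => [|x]; first exact: alg_add.
    by rewrite mulrDl fE gE.
  - move=> f g Pf [Pg [w Pw gE]]; split; first exact: alg_mul.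
    exists (fun v => f v * w v) => [|x]; first exact: alg_mul.
    by rewrite -mulrA gE.
have [v hv] := weak_nullstellensatz pigeonK idI I1.
exfalso; have [[x0 vE]|nZv] :=
    pselect (exists x, forall i : 'I_n, v i = xi i x); last first.
  have [h [Ph /eqP hv0 hZ]] := closed_separated cZ nZv.
  apply: hv0; apply: hv; split=> //; exists (fun=> 0); first exact: alg_cst.
  by move=> x; rewrite hZ ?mul0r //; exists x.
have [_ /(_ _ _ openT ra x0 Logic.I)] := gX.
move=> [c [d [/coords_lift[c' Pc cE] /coords_lift[d' Pd dE] dx0 hd]]].
(* The fraction [c / d] represents [a] only where [d] is nonzero. The square is taken because
   [d * d * a = c * d] holds also where [d] vanishes. *)
have : d' v * d' v = 0.
  apply: (hv (fun v => d' v * d' v)); split; first exact: alg_mul.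
  exists (fun v => c' v * d' v) => [|x]; first exact: alg_mul.
  have [dx|dx] := eqVneq (d x) 0.
    by rewrite -[d' (ev x)]dE dx !(mul0r, mulr0).
  have [_ ->] := hd _ dx; rewrite -[d' (ev x)]dE -[c' (ev x)]cE.
  by field.
rewrite (_ : v = fun i => xi i x0); last exact/funext.
by rewrite -dE; apply/eqP; rewrite mulf_neq0.
Qed.

(** * Symmetric powers *)

(** If all these power sums vanished, so would [\sum_i v_i^2 g(v_i)] for [g] vanishing at the values
    other than [v i0]; this is a positive multiple of a nonzero number. Exponents start at 2 so that
    [a * b ^+ n.+1] vanishes with [b] in [sym_power_genby]. *)
Lemma power_sums_neq0 (K : numFieldType) (I : finType) (v : I -> K) i0 :
  v i0 != 0 -> exists n, \sum_i v i ^+ n.+2 != 0.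
Proof.
move=> v0; apply: contrapT => /forallNP h.
have {}h n : \sum_i v i ^+ n.+2 = 0 by apply/eqP; apply: contrapT => /negP; exact: h.
pose g := \prod_(j | v j != v i0) ('X - (v j)%:P).
have : \sum_i v i ^+ 2 * g.[v i] = 0.
  under eq_bigr do rewrite horner_coef mulr_sumr.
  rewrite exchange_big big1 // => n _.
  under eq_bigr do rewrite mulrCA -exprD.
  by rewrite -mulr_sumr h mulr0.
have g0 i : v i != v i0 -> g.[v i] = 0.
  by move=> vi; rewrite /g (bigD1 i) //= hornerM hornerXsubC subrr mul0r.
rewrite (bigID (fun i => v i == v i0)) /= [X in _ + X]big1 ?addr0; last first.
  by move=> i /g0 ->; rewrite mulr0.
rewrite (eq_bigr (fun=> v i0 ^+ 2 * g.[v i0])); last by move=> i /eqP ->.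
rewrite big_const iter_addr_0 => /eqP; rewrite -mulr_natr !mulf_eq0.
rewrite (negbTE v0) /= Num.Theory.pnatr_eq0 => /orP[|/eqP/card0_eq/(_ i0)].
  rewrite horner_prod => /prodf_eq0[j vj].
  by rewrite hornerXsubC subr_eq0 eq_sym (negbTE vj).
by move=> i0P; have // : i0 \in (pred0 : pred I); rewrite -i0P; exact: eqxx.
Qed.

Lemma big_uniq_tuple_recl (R : nmodType) (I : finType) s
    (F : s.+1.-tuple I -> R) :
  \sum_(t : s.+1.-tuple I | uniq t) F t =
  \sum_(t : s.-tuple I | uniq t) \sum_(i | i \notin t) F [tuple of i :: t].
Proof.
rewrite pair_big_dep /= (reindex (fun p : s.-tuple I * I => [tuple of p.2 :: p.1])).
  by apply: eq_bigl => -[t i] /=; rewrite andbC.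
exists (fun t : s.+1.-tuple I => (behead_tuple t : s.-tuple I, thead t)) => [[t i] _ /=|t _].
  by congr (_, _) => //; apply: val_inj.
by case/tupleP: t => i t; apply: val_inj.
Qed.

(** * Symmetrized functions as polynomials in power sums *)

Section Symmetrization.
Variables (K : fieldType) (X : Type) (d : nat) (A : (X -> K) -> Prop).
Hypothesis Acst : forall c, A (fun=> c).
Hypothesis Amul : forall f g, A f -> A g -> A (fun x => f x * g x).

Definition psum (f : ('I_d -> X) -> K) :=
  exists2 a, A a & f = fun z => \sum_l a (z l).

(** A polarized monomial symmetric function: the factors [f l] are placed at points with distinct
    indices. For [s = d] it is the full symmetrization of a pure tensor. *)
Definition inj_sum s (f : 'I_s -> X -> K) (z : 'I_d -> X) :=
  \sum_(t : s.-tuple 'I_d | uniq t) \prod_l f l (z (tnth t l)).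

(* [f_0] summed over the indices outside [t] is its power sum minus its values
   at the entries of [t], which merge into the other factors. *)
Lemma inj_sum_recl s (f : 'I_s.+1 -> X -> K) z :
  inj_sum f z = (\sum_l f ord0 (z l)) * inj_sum (fun l => f (lift ord0 l)) z -
    \sum_b inj_sum (fun l x => f (lift ord0 l) x *
      (if l == b then f ord0 x else 1)) z.
Proof.
rewrite /inj_sum big_uniq_tuple_recl exchange_big /= mulr_sumr -sumrB.
apply: eq_bigr => t ut; set p := \prod_l _.
transitivity (\sum_(i | i \notin t) f ord0 (z i) * p).
  apply: eq_bigr => i _; rewrite big_ord_recl; congr (_ * _).
  by apply: eq_bigr => l _; rewrite tnthS.
rewrite -mulr_suml [in RHS](bigID (mem t)) /= mulrDl addrAC.
rewrite -[LHS]add0r; congr (_ + _); symmetry; apply/eqP; rewrite subr_eq0.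
rewrite -(big_uniq _ ut) big_tuple mulr_suml; apply/eqP/eq_bigr => b _.
by rewrite big_split /= mulrC; congr (_ * _); rewrite -big_mkcond big_pred1_eq.
Qed.

Lemma inj_sum_alg s (f : 'I_s -> X -> K) :
  (forall l, A (f l)) -> alg psum (inj_sum f).
Proof.
elim: s f => [|s IH] f Af.
  apply: (@alg_ext _ _ _ (fun=> \sum_(t : 0.-tuple 'I_d | uniq t) 1)).
    by move=> z; apply: eq_bigr => t _; rewrite big_ord0.
  exact: alg_cst.
apply: alg_ext (fun z => esym (inj_sum_recl f z)) _.
apply: alg_sub; first apply: alg_mul.
- by apply: alg_base; exists (f ord0).
- exact: IH.
- apply: alg_sum => b _; apply: IH => l; apply: Amul => //.
  by case: eqP.
Qed.

Definition proj_fun (f : ('I_d -> X) -> K) :=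
  exists l a, A a /\ f = fun z => a (z l).

Inductive prod_sum : (('I_d -> X) -> K) -> Prop :=
| prod_sum_mon c f : (forall l, A (f l)) ->
    prod_sum (fun z => c * \prod_l f l (z l))
| prod_sum_add f g : prod_sum f -> prod_sum g -> prod_sum (fun z => f z + g z).

Lemma alg_prod_sum f : alg proj_fun f -> prod_sum f.
Proof.
have ext g h : g =1 h -> prod_sum g -> prod_sum h by move=> /funext ->.
elim=> {f} [_ [l [a [Aa ->]]]|c|f g _ Ff _ Fg|f g _ Ff _ Fg].
- apply: ext (@prod_sum_mon 1 (fun l' => if l' == l then a else fun=> 1) _).
    move=> z; rewrite mul1r (bigD1 l) //= eqxx big1 ?mulr1 //.
    by move=> l' /negbTE ->.
  by move=> l'; case: eqP.
- apply: ext (@prod_sum_mon c (fun _ _ => 1) _) => [z|//].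
  by rewrite big1 ?mulr1.
- exact: prod_sum_add.
- elim: Ff => {f} [c f Af|f f' _ IH _ IH'].
    elim: Fg => {g} [c' g Ag|g g' _ IH _ IH'].
      apply: ext (@prod_sum_mon (c * c') (fun l x => f l x * g l x) _).
        by move=> z; rewrite big_split /= mulrACA.
      by move=> l; exact: Amul.
    by apply: ext (prod_sum_add IH IH') => z; rewrite mulrDr.
  by apply: ext (prod_sum_add IH IH') => z; rewrite mulrDl.
Qed.

(** Repetition-free [d]-tuples of indices are the permutations, so a sum of pure tensors symmetrizes
    to a combination of functions [inj_sum], to which [inj_sum_alg] applies. *)
Lemma symmetrize_alg f : alg proj_fun f ->
  alg psum (fun z => \sum_(t : d.-tuple 'I_d | uniq t)
    f (fun l => z (tnth t l))).
Proof.
move=> /alg_prod_sum; elim=> {f} [c f Af|f g _ Ff _ Fg].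
  apply: alg_ext (alg_mul (alg_cst _ c) (inj_sum_alg Af)) => z.
  by rewrite mulr_sumr.
by apply: alg_ext (alg_add Ff Fg) => z; rewrite big_split.
Qed.

End Symmetrization.

(** * Zero-cycles as functionals *)

Section Zcycles.
Variables (K : numFieldType) (X : choiceType).

Lemma zcycle_sum_mem n (m : 'I_n -> nat) (x : 'I_n -> X) (s : seq X) (f : X -> K) :
  uniq s -> (forall l, x l \in s) ->
  \sum_l (m l)%:R * f (x l) = \sum_(y <- s) (zcycle m x y)%:R * f y.
Proof.
move=> us xs; under [RHS]eq_bigr do rewrite natr_sum mulr_suml.
rewrite exchange_big; apply: eq_bigr => l _ /=.
rewrite (bigD1_seq (x l)) //= asboolT // muln1 big1 ?addr0 // => y yx.
by rewrite asboolF ?muln0 ?mul0r // => xy; rewrite xy eqxx in yx.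
Qed.

Lemma zcycle_sum n n' (m : 'I_n -> nat) (m' : 'I_n' -> nat)
    (x : 'I_n -> X) (x' : 'I_n' -> X)
    (f : X -> K) : zcycle m x = zcycle m' x' ->
  \sum_l (m l)%:R * f (x l) = \sum_l (m' l)%:R * f (x' l).
Proof.
move=> xx'; pose s := undup ([seq x l | l <- enum 'I_n] ++
  [seq x' l | l <- enum 'I_n']).
rewrite !(@zcycle_sum_mem _ _ _ s) ?undup_uniq ?xx' // => l.
  by rewrite mem_undup mem_cat map_f ?mem_enum ?orbT.
by rewrite mem_undup mem_cat orbC map_f ?mem_enum ?orbT.
Qed.

Lemma zcycle_mass n (m : 'I_n -> nat) (x : 'I_n -> X) y :
  (zcycle m x y)%:R = \sum_l (m l)%:R * (`[< x l = y >] : nat)%:R :> K.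
Proof. by rewrite natr_sum; apply: eq_bigr => l _; rewrite natrM. Qed.

Lemma zcycle_eq n n' (m : 'I_n -> nat) (m' : 'I_n' -> nat)
    (x : 'I_n -> X) (x' : 'I_n' -> X) :
  (forall f : X -> K,
    \sum_l (m l)%:R * f (x l) = \sum_l (m' l)%:R * f (x' l)) ->
  zcycle m x = zcycle m' x'.
Proof.
move=> h; apply/funext => y; apply/eqP.
rewrite -(Num.Theory.eqr_nat K) !zcycle_mass; apply/eqP.
exact: (h (fun z => (`[< z = y >] : nat)%:R)).
Qed.

End Zcycles.

Section SymPower.
Variables (K : numFieldType) (X : fspace K) (d : nat).

Definition cycle_of (z : 'I_d -> X) : sym_power d X :=
  exist _ (zcycle (fun=> 1%N) z) (zcycle_in z).

Definition power_sum (h : sym_power d X -> K) := exists2 a : X -> K,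
  reg setT a & forall z, h (cycle_of z) = \sum_l a (z l).

Lemma cycle_of_surj (c : sym_power d X) : exists z, c = cycle_of z.
Proof.
have [z _ zc] := set_mem (valP c); exists z; apply: val_inj; exact: esym.
Qed.

Lemma cycle_of_tuple (z : 'I_d -> X) (t : d.-tuple 'I_d) :
  uniq t -> cycle_of (fun l => z (tnth t l)) = cycle_of z.
Proof.
move=> /tuple_uniqP injt; apply: val_inj; apply/funext => y /=.
rewrite /zcycle [RHS](reindex (tnth t)) //.
by apply: onW_bij; exact: injF_bij.
Qed.

Lemma power_sum_exists (a : X -> K) : reg setT a ->
  exists2 h, power_sum h & forall z, h (cycle_of z) = \sum_l a (z l).
Proof.
move=> ra; have [r hr] := choice cycle_of_surj.
have hE z : \sum_l a (r (cycle_of z) l) = \sum_l a (z l).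
  have e (x : 'I_d -> X) : \sum_l (1%N)%:R * a (x l) = \sum_l a (x l).
    by apply: eq_bigr => l _; rewrite mul1r.
  by rewrite -!e; apply: zcycle_sum; rewrite [RHS](congr1 val (hr (cycle_of z))).
by exists (fun c => \sum_l a (r c l)) => //; exists a.
Qed.

Lemma alg_psum_lift f : alg (psum (d := d) (@reg K X setT)) f ->
  exists2 h, alg power_sum h & forall z, f z = h (cycle_of z).
Proof.
elim=> {f} [_ [a ra ->]|c|f g _ [h Ph fE] _ [k Pk gE]
                          |f g _ [h Ph fE] _ [k Pk gE]].
- have [h Ph hE] := power_sum_exists ra.
  by exists h => //; exact: alg_base.
- by exists (fun=> c) => //; exact: alg_cst.
- by exists (fun v => h v + k v) => [|z]; [exact: alg_add|rewrite fE gE].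
- by exists (fun v => h v * k v) => [|z]; [exact: alg_mul|rewrite fE gE].
Qed.

(** Near an ordered tuple [y], [g] is [a / b]. As [g] is symmetric, [g * b ^+ n.+2 = a * b ^+ n.+1]
    holds for every permutation of the pair, also where [b] vanishes, and summing over permutations
    writes [g] as a quotient of symmetric functions. The exponent is chosen to keep the denominator
    nonzero at [y]. *)
Lemma sym_power_genby B : genby (X := X) B -> genby power_sum.
Proof.
move=> gB; have [rext rres rglue rcst radd rmul rinv] := fspaceP X.
have gX : genby (@reg K X setT).
  by apply: (genby_trans gB) => // b Bb; apply: alg_base; exact: gB.1.
have gP := prod_genby (fun _ : 'I_d => gX); split.
  move=> h [a ra hE]; rewrite /reg /= /final_reg.
  rewrite (_ : _ \o _ = fun z : prod_space (fun _ : 'I_d => X) => \sum_l a (z l));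
    last by apply/funext => z; exact: hE.
  apply: (reg_alg gP.1); apply: alg_sum => l _; apply: alg_base.
  by exists l, a.
move=> W g oW rg c; have [y ->] := cycle_of_surj c => Wy.
have [_ /(_ _ _ oW rg y Wy)[a [b [Pa Pb by0 hb]]]] := gP.
(* The values of [b] at the permuted [y], extended by 0 to all tuples; the added terms do not change
   positive power sums. *)
pose v (t : d.-tuple 'I_d) := if uniq t then b (fun l => y (tnth t l)) else 0.
have uid : uniq (ord_tuple d) by rewrite val_ord_tuple enum_uniq.
have [|n hn] := @power_sums_neq0 K _ v (ord_tuple d).
  rewrite /v uid (_ : (fun l => _) = y) //.
  by apply/funext => l; rewrite tnth_ord_tuple.
have Acst (x : K) : reg (f := X) setT (fun=> x) by apply: rcst; exact: openT.
have Amul (f1 f2 : X -> K) : reg setT f1 -> reg setT f2 ->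
  reg setT (fun x => f1 x * f2 x) by apply: rmul; exact: openT.
have [G PG GE] := alg_psum_lift (symmetrize_alg Acst Amul
  (alg_mul Pa (alg_exp n.+1 Pb))).
have [H PH HE] := alg_psum_lift (symmetrize_alg Acst Amul (alg_exp n.+2 Pb)).
exists G, H; split=> //.
  rewrite -HE big_mkcond; move: hn; congr (is_true (_ != 0)); apply: eq_bigr => t _.
  by rewrite /v; case: ifP => // _; rewrite expr0n.
move=> c'; have [z ->] := cycle_of_surj c' => Hz.
have bz (t : d.-tuple 'I_d) : uniq t -> b (fun l => z (tnth t l)) != 0 ->
    W (cycle_of z) /\ g (cycle_of z) =
      a (fun l => z (tnth t l)) / b (fun l => z (tnth t l)).
  by move=> ut /hb; rewrite /preimage /= -/(cycle_of _) cycle_of_tuple.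
split.
  apply: contrapT => nW; move/eqP: Hz; apply; rewrite -HE big1 // => t ut.
  apply/eqP; rewrite expf_eq0 /=; apply/negPn/negP => /(bz t ut)[]; exact.
apply: (canRL (mulfK Hz)); rewrite -HE -GE mulr_sumr; apply: eq_bigr => t ut.
have [->|bt] := eqVneq (b (fun l => z (tnth t l))) 0.
  by rewrite !expr0n !mulr0.
have [_ ->] := bz t ut bt.
by rewrite exprS mulrA divfK.
Qed.

End SymPower.

(** * Integrality over the moments *)

Section Integrality.
Variables (K : fieldType) (Q : comNzRingType) (E : Type) (k r : nat).
Variables (ev : E -> {rmorphism Q -> K}) (y : 'I_k -> E -> K).
Variables (qm : 'I_k -> 'I_r -> Q) (qp : nat -> 'I_r -> Q).
Variables (J : {set 'I_k} -> 'I_r) (qs : {set 'I_k} -> Q).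
Hypothesis qpE : forall e a j, (0 < a <= k)%N ->
  ev e (qp a j) = \sum_i ev e (qm i j) * y i e ^+ a.
Hypothesis qsE : forall e S, S != finset.set0 ->
  ev e (qs S) * \sum_(i in S) ev e (qm i (J S)) = 1.

(** [Q] plays the ring generated by weights [qm], moments [qp] and inverse subset sums [qs].
    Coefficients are compared only as functions on [E], so relations need not hold in [Q] itself. *)
Definition coef_fun (f : E -> K) := exists q, f = fun e => ev e q.
Notation filt := (filt coef_fun y).

Lemma coef_funD f g : coef_fun f -> coef_fun g -> coef_fun (fun e => f e + g e).
Proof.
move=> [q ->] [q' ->]; exists (q + q'); apply/funext => e; by rewrite rmorphD.
Qed.

Lemma coef_funM f g : coef_fun f -> coef_fun g -> coef_fun (fun e => f e * g e).
Proof.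
move=> [q ->] [q' ->]; exists (q * q'); apply/funext => e; by rewrite rmorphM.
Qed.

Lemma coef_fun0 : coef_fun (fun=> 0).
Proof. by exists 0; apply/funext => e; rewrite rmorph0. Qed.

Lemma coef_fun1 : coef_fun (fun=> 1).
Proof. by exists 1; apply/funext => e; rewrite rmorph1. Qed.

Let filtM d d' f g : filt d f -> filt d' g ->
  filt (d + d') (fun e => f e * g e).
Proof. exact: (filt_mul coef_funM). Qed.

Let filt_ev d q : filt d (fun e => ev e q).
Proof. by apply: filt_cst; exists q. Qed.

Let filtX d f n : filt d f -> filt (d * n) (fun e => f e ^+ n).
Proof.
move=> Ff; elim: n => [|n IH].
  apply: filt_ext (filt_cst _ (d * 0)%N coef_fun1) => e; by rewrite expr0.
by rewrite mulnS; apply: filt_ext (filtM Ff IH) => e; rewrite exprS.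
Qed.

(** The class of [f] in degree [d] of the associated graded ring is zero. For [d = 0] nothing
    qualifies, not even zero, whence the positivity conditions on sums. *)
Definition low d f := exists2 d', (d' < d)%N & filt d' f.

Lemma low_filt d f : low d f -> filt d f.
Proof. by move=> [d' dd' Ff]; apply: filt_le Ff; exact: ltnW. Qed.

Lemma low_ext d f g : f =1 g -> low d f -> low d g.
Proof. by move=> /funext ->. Qed.

Lemma lowD d f g : low d f -> low d g -> low d (fun e => f e + g e).
Proof.
move=> [d' dd' Ff] [d'' dd'' Fg]; exists (maxn d' d'').
  by rewrite gtn_max dd'.
by apply: filt_add; [apply: filt_le Ff|apply: filt_le Fg];
  rewrite ?leq_maxl ?leq_maxr.
Qed.

Lemma lowM d d' f g : filt d f -> low d' g -> low (d + d') (fun e => f e * g e).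
Proof.
by move=> Ff [d'' dd'' Fg]; exists (d + d'')%N; [rewrite ltn_add2l|exact: filtM].
Qed.

Lemma low_sum d (I : Type) (s : seq I) (F : I -> E -> K) : (0 < d)%N ->
  (forall i, low d (F i)) -> low d (fun e => \sum_(i <- s) F i e).
Proof.
move=> d0 h; elim: s => [|i s IH].
  exists 0%N => //; apply: filt_ext (filt_cst _ 0%N coef_fun0) => e.
  by rewrite big_nil.
by apply: low_ext (lowD (h i) IH) => e; rewrite big_cons.
Qed.

Lemma lowX d f n m : filt d f -> (n <= m)%N ->
  low (d * n) (fun e => f e ^+ n) -> low (d * m) (fun e => f e ^+ m).
Proof.
move=> Ff nm Lf; rewrite -(subnK nm) mulnDr.
by apply: low_ext (lowM (filtX (m - n) Ff) Lf) => e; rewrite exprD.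
Qed.

(* [f] has degree at most [d] and its class in degree [d] of the associated
   graded ring is nilpotent. *)
Definition nilp d f := filt d f /\ exists n, low (d * n) (fun e => f e ^+ n).

Lemma nilp_ext d f g : f =1 g -> nilp d f -> nilp d g.
Proof. by move=> /funext ->. Qed.

Lemma nilp_low d f : low d f -> nilp d f.
Proof. by move=> Lf; split; [exact: low_filt|exists 1%N; rewrite muln1]. Qed.

Lemma nilpM d d' f g : filt d f -> nilp d' g ->
  nilp (d + d') (fun e => f e * g e).
Proof.
move=> Ff [Fg [n Lg]]; split; first exact: filtM.
exists n; rewrite mulnDl.
by apply: low_ext (lowM (filtX n Ff) Lg) => e; rewrite exprMn.
Qed.

Lemma nilpD d f g : nilp d f -> nilp d g -> nilp d (fun e => f e + g e).
Proof.
move=> [Ff [n Lf]] [Fg [m Lg]]; split; first exact: filt_add.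
(* In each term of the binomial expansion either [g] has exponent at least [m] or [f] has exponent
   at least [n]. *)
exists (n + m)%N.
(* Since [low] is empty in degree 0, [Lf] already gives [0 < d * n]. *)
have dnm : (0 < d * (n + m))%N.
  case: Lf => d' + _; rewrite mulnDr; case: (d * n)%N => //.
apply: low_ext (fun e => esym (exprDn (f e) (g e) (n + m))) _.
apply: (@low_sum _ _ _ (fun (i : 'I_(n + m).+1) e =>
  f e ^+ (n + m - i) * g e ^+ i *+ 'C(n + m, i))) => // i.
suff : low (d * (n + m)) (fun e => f e ^+ (n + m - i) * g e ^+ i).
  move=> /(lowM (filt_ev 0 ('C(n + m, i))%:R)); rewrite add0n.
  by apply: low_ext => e; rewrite rmorph_nat mulr_natl.
have inm : (i <= n + m)%N by rewrite -ltnS.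
have -> : (d * (n + m) = d * (n + m - i) + d * i)%N by rewrite -mulnDr subnK.
have [im|mi] := leqP m i.
  by apply: lowM; [exact: filtX|exact: lowX im Lg].
rewrite addnC; apply: (@low_ext _ (fun e => g e ^+ i * f e ^+ (n + m - i))).
  by move=> e; rewrite mulrC.
apply: lowM; first exact: filtX.
by apply: lowX Lf => //; rewrite -addnBA ?leq_addr // ltnW.
Qed.

Lemma nilp_sum d (I : Type) (s : seq I) (P : pred I) (F : I -> E -> K) :
  (0 < d)%N -> (forall i, P i -> nilp d (F i)) ->
  nilp d (fun e => \sum_(i <- s | P i) F i e).
Proof.
move=> d0 h; elim: s => [|i s IH].
  apply: nilp_low; exists 0%N => //.
  by apply: filt_ext (filt_cst _ 0%N coef_fun0) => e; rewrite big_nil.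
case Pi: (P i).
  by apply: nilp_ext (nilpD (h i Pi) IH) => e; rewrite big_cons Pi.
by apply: nilp_ext IH => e; rewrite big_cons Pi.
Qed.

Lemma nilp_root d f : filt d f -> nilp (d + d) (fun e => f e * f e) -> nilp d f.
Proof.
move=> Ff [_ [n Lf]]; split=> //; exists (n + n)%N.
rewrite mulnDr -mulnDl; apply: low_ext Lf => e.
by rewrite exprMn exprD.
Qed.

(** Up to sign these coefficients are elementary symmetric functions of the [y i]. *)
Lemma filt_coef (s : seq 'I_k) a :
  filt (size s - a) (fun e => (\prod_(i <- s) ('X - (y i e)%:P))`_a).
Proof.
elim: s a => [|i s IH] a.
  case: a => [|a].
    by apply: filt_ext (filt_cst _ _ coef_fun1) => e; rewrite big_nil coef1.
  by apply: filt_ext (filt_cst _ _ coef_fun0) => e; rewrite big_nil coef1.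
have E1 e : (\prod_(l <- i :: s) ('X - (y l e)%:P))`_a =
    (if a is a'.+1 then (\prod_(l <- s) ('X - (y l e)%:P))`_a' else 0) +
    ev e (-1) * (y i e * (\prod_(l <- s) ('X - (y l e)%:P))`_a).
  rewrite big_cons mulrBl coefB coefXM coefCM rmorphN1 mulN1r.
  by case: a.
apply: filt_ext (fun e => esym (E1 e)) _ => {E1}.
(* Beyond [size s] the natural subtraction truncates; there the second coefficient is zero. *)
have [sa|as_] := ltnP (size s) a.
  apply: (@filt_ext _ _ _ _ _ _
    (fun e => if a is a'.+1 then (\prod_(l <- s) ('X - (y l e)%:P))`_a' else 0)).
    move=> e; rewrite [X in _ * (_ * X)]nth_default ?mulr0 ?addr0 //.
    by rewrite size_prod_XsubC.
  by case: a sa => // a _; exact: IH.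
apply: filt_add.
  by case: a as_ => [|a] _; [exact: (filt_cst _ _ coef_fun0)|exact: IH].
rewrite -[(_ - a)%N]add0n; apply: filtM; first exact: filt_ev.
by rewrite subSn // -add1n; apply: filtM => //; exact: (filt_var _ coef_fun1).
Qed.

Let mono (S : {set 'I_k}) e := \prod_(i in S) y i e.

Let filt_mono (S : {set 'I_k}) : filt #|S| (mono S).
Proof.
apply: filt_ext (@filt_mon _ _ _ _ _ _ _ (fun i => (i \in S) : nat) coef_fun1 _).
  move=> e; rewrite mul1r /mono [RHS]big_mkcond; apply: eq_bigr => i _.
  by case: (i \in S); rewrite ?expr1 ?expr0.
by rewrite -sum1_card [X in (_ <= X)%N]big_mkcond leq_sum // => i _; case: ifP.
Qed.

(** [c] vanishes at every [y i] with [i] in [S], so [\sum_(i in S) m_i c(y_i) = 0]. Its constant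
    term contributes [(-1)^|S| m_S y_S]. Solve for it with [qs S], multiply by [y_S], and write each
    sum over [S] of [m_i y_i^(a+1)] as the full moment minus the terms outside [S]; there one factor
    [y_i] is absorbed into the monomial of the larger set [i |: S]. *)
Let mono_sq (S : {set 'I_k}) e (c := (\prod_(i in S) ('X - (y i e)%:P)) : {poly K})
    (j := J S) : S != finset.set0 ->
  mono S e * mono S e = ev e (- (-1) ^+ #|S| * qs S) *
    \sum_(a < #|S|) c`_a.+1 * (mono S e * ev e (qp a.+1 j) +
      ev e (-1) * \sum_(i | i \notin S)
        ev e (qm i j) * y i e ^+ a * mono (i |: S) e).
Proof.
move=> S0.
have c0 : c`_0 = (-1) ^+ #|S| * mono S e.
  rewrite -horner_coef0 horner_prod -prodrN; apply: eq_bigr => i _.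
  by rewrite hornerXsubC sub0r.
have sc : size c = #|S|.+1.
  by rewrite /c -big_enum size_prod_XsubC -cardE.
have rec : \sum_(a < #|S|.+1) c`_a * \sum_(i in S) ev e (qm i j) * y i e ^+ a = 0.
  under eq_bigr do rewrite mulr_sumr.
  rewrite exchange_big big1 //= => i iS.
  under eq_bigr do rewrite mulrCA.
  rewrite -mulr_sumr -sc -horner_coef /c horner_prod (bigD1 i) //=.
  by rewrite hornerXsubC subrr mul0r mulr0.
have pS (a : 'I_#|S|) : mono S e * ev e (qp a.+1 j) +
      ev e (-1) * \sum_(i | i \notin S)
        ev e (qm i j) * y i e ^+ a * mono (i |: S) e =
    mono S e * \sum_(i in S) ev e (qm i j) * y i e ^+ a.+1.
  rewrite qpE; last first.
    by rewrite /= (leq_trans (ltn_ord a)) // -[X in (_ <= X)%N]card_ord max_card.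
  rewrite [\sum_i _ * _](bigID (mem S)) /= mulrDr rmorphN1 mulN1r -addrA.
  rewrite [X in _ + X](_ : _ = 0) ?addr0 //; apply/eqP; rewrite subr_eq0.
  rewrite mulr_sumr; apply/eqP/eq_bigr => i iS.
  by rewrite /mono big_setU1 //= exprSr; ring.
rewrite (eq_bigr _ (fun (a : 'I_#|S|) _ => congr1 (fun x => c`_a.+1 * x) (pS a))).
set s0 := \sum_(i in S) ev e (qm i j).
have {}rec : (-1) ^+ #|S| * mono S e * s0 + \sum_(a < #|S|)
    c`_a.+1 * \sum_(i in S) ev e (qm i j) * y i e ^+ a.+1 = 0.
  rewrite -[RHS]rec big_ord_recl -c0; congr (_ * _ + _).
  by apply: eq_bigr => i _; rewrite expr0 mulr1.
under eq_bigr do rewrite mulrCA.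
rewrite -mulr_sumr; move/eqP: rec; rewrite addrC addr_eq0 => /eqP ->.
have := qsE e S0; rewrite -/j -/s0 => qs1.
rewrite rmorphM rmorphN rmorphXn rmorphN1.
have sgn : (-1) ^+ #|S| * (-1) ^+ #|S| = 1 :> K.
  by rewrite -exprMn mulrNN mulr1 expr1n.
transitivity (((-1) ^+ #|S| * (-1) ^+ #|S|) * (ev e (qs S) * s0) * (mono S e * mono S e)).
  by rewrite sgn qs1 !mul1r.
by ring.
Qed.

(* Descending induction on [S], by [mono_sq]. *)
Lemma nilp_mono (S : {set 'I_k}) : S != finset.set0 -> nilp #|S| (mono S).
Proof.
have [n] := ubnP (k - #|S|)%N; elim: n S => // n IH S kS S0.
have Sgt0 : (0 < #|S|)%N by rewrite card_gt0.
apply: nilp_root; first exact: filt_mono.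
apply: nilp_ext (fun e => esym (mono_sq e S0)) _.
rewrite -[(_ + _)%N]add0n; apply: nilpM; first exact: filt_ev.
apply: nilp_sum => [|a _]; first by rewrite addn_gt0 Sgt0.
have -> : (#|S| + #|S| = (#|S| - a.+1) + (#|S| + a.+1))%N.
  by rewrite [RHS]addnCA subnK.
apply: nilpM.
  have := filt_coef (enum S) a.+1; rewrite -cardE; apply: filt_ext => e.
  by rewrite big_enum.
apply: nilpD.
  apply: nilp_low; exists #|S|; first by rewrite addnS ltnS leq_addr.
  by rewrite -[X in filt X]addn0; apply: filtM; [exact: filt_mono|exact: filt_ev].
rewrite -[(_ + _.+1)%N]add0n; apply: nilpM; first exact: filt_ev.
apply: nilp_sum => [|i iS]; first by rewrite addnS.
have -> : (#|S| + a.+1 = a + #|i |: S|)%N by rewrite cardsU1 iS addnS addnC add1n addnS.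
apply: nilpM; last first.
  apply: IH; last by apply/set0Pn; exists i; rewrite setU11.
  rewrite cardsU1 iS add1n subnS prednK //.
  rewrite subn_gt0 -[X in (_ < X)%N]card_ord -cardsT.
  by apply: proper_card; rewrite properT; apply: contraNneq iS => ->; rewrite inE.
rewrite -[X in filt X]add0n; apply: filtM; first exact: filt_ev.
by rewrite -[X in filt X]mul1n; apply: filtX; exact: (filt_var _ coef_fun1).
Qed.

(** By [nilp_mono] some power [y_i^N] is a combination of monomials of degree below [N]. A monomial
    of degree above [k * N] has an exponent at least [N], and rewriting that power lowers the
    degree. *)
Lemma filt_bounded : exists D, forall d f, filt d f -> filt D f.
Proof.
have [N hN] : exists N, forall i, low N (fun e => y i e ^+ N).
  have /choice[N hN] i : exists n, low n (fun e => y i e ^+ n).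
    have [|_ [n]] := @nilp_mono [set i]%SET; first by rewrite -cards_eq0 cards1.
    rewrite cards1 mul1n => Ln; exists n; apply: low_ext Ln => e.
    by rewrite /mono big_set1.
  exists (\max_i N i)%N => i; rewrite -[X in low X]mul1n.
  apply: (lowX (n := N i)); last by rewrite mul1n.
    exact: (filt_var _ coef_fun1).
  exact: (leq_bigmax_cond (F := N)).
exists (k * N)%N => d; have [n] := ubnP d; elim: n d => // n IH d dn f Ff.
have {}IH d' g : (d' < d)%N -> filt d' g -> filt (k * N) g.
  by move=> d'd; apply: IH; exact: leq_trans d'd _.
elim: Ff IH => {d f dn} [d c b Cc bd|d f g _ Hf _ Hg] IH; last first.
  by apply: filt_add; [exact: Hf|exact: Hg].
have [bN|] := leqP (\sum_i b i) (k * N); first exact: filt_mon.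
move=> bN.
have [i Nb] : exists i, (N <= b i)%N.
  apply: contrapT => /forallNP h; move: bN; rewrite ltnNge => /negP; apply.
  rewrite -[k in (_ <= k * _)%N]card_ord -sum_nat_const leq_sum // => i _.
  by rewrite ltnW // ltnNge; apply/negP.
have [N' N'N FN] := hN i.
pose b' l := (b l - (l == i) * N)%N.
have sb : (\sum_l b' l + N = \sum_l b l)%N.
  rewrite (bigD1 i) //= [RHS](bigD1 i) //= /b' eqxx mul1n addnAC subnK //.
  congr (_ + _)%N; apply: eq_bigr => l /negbTE ->; by rewrite mul0n subn0.
apply: (IH (N' + \sum_l b' l)%N).
  by apply: leq_trans bd; rewrite -sb addnC ltn_add2l.
apply: filt_ext (filtM FN (filt_mon (b := b') _ Cc (leqnn _))) => e.
rewrite mulrCA; congr (_ * _); rewrite (bigD1 i) //= [RHS](bigD1 i) //= mulrA.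
rewrite /b' eqxx mul1n -exprD subnKC //; congr (_ * _).
by apply: eq_bigr => l /negbTE ->; rewrite mul0n subn0.
Qed.

(** The determinant trick: monomials with exponents at most [D] span a module stable under each
    [y i], so their values at [e] form an eigenvector of a matrix over [Q] specialized at [e],
    nonzero because the empty monomial is 1. The product of the characteristic polynomials serves
    all [i] at once. *)
Lemma integrality : exists2 F : {poly Q}, F \is monic &
  forall e i, root (map_poly (ev e) F) (y i e).
Proof.
have [D hD] := filt_bounded.
pose B := {ffun 'I_k -> 'I_D.+1}; pose w (b : B) e := \prod_i y i e ^+ b i.
have /choice[M hM] i : exists M : 'M[Q]_#|B|, forall e,
    (\row_b w (enum_val b) e) *m map_mx (ev e) M =
    y i e *: \row_b w (enum_val b) e.
  have /choice[l hl] b : exists l : B -> Q, forall e,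
      y i e * w b e = \sum_b' ev e (l b') * w b' e.
    have [|||l Cl lE] := @filt_normal _ _ _ coef_fun y _ _ D
        (fun e => y i e * w b e).
    - exact: coef_fun0.
    - exact: coef_funD.
    - apply: (hD (1 + \sum_i b i)%N); apply: filtM; first exact: (filt_var _ coef_fun1).
      apply: filt_ext (filt_mon (b := fun l => b l : nat) _ coef_fun1
        (leqnn _)) => e.
      by rewrite mul1r.
    have [q hq] := choice Cl; exists q => e.
    by rewrite lE; apply: eq_bigr => b' _; rewrite hq.
  exists (\matrix_(b', b) l (enum_val b) (enum_val b')) => e.
  apply/rowP => b; rewrite !mxE hl [RHS](reindex (fun j : 'I_#|B| => enum_val j)) /=; last first.
    by apply: onW_bij; exact: enum_val_bij.
  by apply: eq_bigr => b' _; rewrite !mxE mulrC.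
exists (\prod_i char_poly (M i)); first by rewrite monic_prod // => i _; exact: char_poly_monic.
move=> e i; rewrite rmorph_prod /= /root horner_prod (bigD1 i) //= mulf_eq0.
apply/orP; left; rewrite map_char_poly -/(root _ _) -eigenvalue_root_char.
apply/eigenvalueP; exists (\row_b w (enum_val b) e); first exact: hM.
apply/eqP => /rowP/(_ (enum_rank [ffun=> ord0])); rewrite !mxE enum_rankK /w.
rewrite big1 => [/eqP|l _]; first by rewrite oner_eq0.
by rewrite ffunE expr0.
Qed.

End Integrality.

(** * Lying over *)

Lemma horner_mx_eigen (R : comNzRingType) n (A : 'M[R]_n.+1) (v : 'rV_n.+1)
    b (p : {poly R}) :
  v *m A = b *: v -> v *m horner_mx A p = p.[b] *: v.
Proof.
move=> vA; elim/poly_ind: p => [|p c IH].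
  by rewrite rmorph0 mulmx0 horner0 scale0r.
rewrite rmorphD rmorphM /= horner_mx_X horner_mx_C mulmxDr -[_ * A]/(_ *m A).
rewrite mulmxA IH -scalemxAl vA scalerA mul_mx_scalar hornerD hornerM hornerX.
by rewrite hornerC scalerDl.
Qed.

(* The powers of a root of [F] form an eigenvector of the companion matrix of
   [F * 'X]; the extra ['X] keeps the matrix nonempty. *)
Lemma horner_det_ideal (Q : comNzRingType) (E : Type) (K : fieldType)
    (ev : E -> {rmorphism Q -> K}) (F g : {poly Q}) (b : E -> K) :
  F \is monic -> (forall e, root (map_poly (ev e) F) (b e)) ->
  (forall e, (map_poly (ev e) g).[b e] = 0) ->
  exists n (C : 'M[Q]_n.+1), forall e, ev e (\det (horner_mx C g)) = 0.
Proof.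
move=> mF rF g0; pose n := (size F).-1.
have sF : size (F * 'X) = n.+2.
  by rewrite size_mulX ?monic_neq0 // prednK // size_poly_gt0 monic_neq0.
have lF : (F * 'X)`_n.+1 = 1.
  by move: mF => /monicP; rewrite -(lead_coefMX F) lead_coefE sF.
exists n, (\matrix_(i < n.+1, j < n.+1) if (j < n)%N then (i == j.+1 :> nat)%:R
  else - (F * 'X)`_i) => e.
set C := \matrix_(i, j) _.
rewrite -det_map_mx map_horner_mx; apply/eqP/det0P.
exists (\row_j b e ^+ j).
  apply/eqP => /rowP/(_ ord0); rewrite !mxE expr0 => /eqP; by rewrite oner_eq0.
rewrite (@horner_mx_eigen _ _ _ _ (b e)) ?g0 ?scale0r //.
apply/rowP => j; rewrite !mxE.
under eq_bigr do rewrite !mxE.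
have [jn|nj] := ltnP j n.
  rewrite (bigD1 (inord j.+1)) //= inordK ?ltnS // eqxx rmorph1 mulr1 exprS.
  rewrite big1 ?addr0 // => i; rewrite -val_eqE /= inordK ?ltnS // => /negbTE ->.
  by rewrite rmorph0 mulr0.
have -> : j = n :> nat by apply/eqP; rewrite eqn_leq nj -ltnS ltn_ord.
have : root (map_poly (ev e) (F * 'X)) (b e).
  by rewrite rmorphM rootM /= rF.
rewrite /root horner_coef size_map_poly_id0; last first.
  by rewrite lead_coefE sF lF rmorph1 oner_neq0.
rewrite sF big_ord_recr /=.
have -> : (map_poly (ev e) (F * 'X))`_n.+1 = 1.
  by rewrite coef_map lF; exact: rmorph1.
rewrite mul1r addrC addr_eq0 -exprS => /eqP ->.
rewrite -sumrN; apply: eq_bigr => i _.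
by rewrite coef_map rmorphN /= mulrN mulrC.
Qed.

Section LyingOver.
Variables (K : closedFieldType) (E : Type).

(** [al] is a point of the Zariski closure of the points [ev e]. *)
Definition adherent (Q : comNzRingType) (ev : E -> {rmorphism Q -> K})
  (al : {rmorphism Q -> K}) := forall q, (forall e, ev e q = 0) -> al q = 0.

(** The images under [al] of the relations satisfied by [b] form an ideal of [K[X]], as [al] is
    onto. An element of least degree is not constant: the determinant from [horner_det_ideal]
    vanishes on [E], hence under [al], but its image would be a power of that constant. Any root of
    this element will do. *)
Lemma lying_over1 (Q : comNzRingType) (ev : E -> {rmorphism Q -> K})
    (al : {rmorphism Q -> K}) (F : {poly Q}) (b : E -> K) :
  (forall x, exists q, al q = x) -> adherent ev al ->
  F \is monic -> (forall e, root (map_poly (ev e) F) (b e)) ->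
  exists be, forall g, (forall e, (map_poly (ev e) g).[b e] = 0) ->
    (map_poly al g).[be] = 0.
Proof.
move=> /choice[s als] adh mF rF.
pose I (g : {poly Q}) := forall e, (map_poly (ev e) g).[b e] = 0.
pose P n := `[< exists g, [/\ I g, map_poly al g != 0 & size (map_poly al g) = n] >].
have exP : exists n, P n.
  exists (size (map_poly al F)); apply/asboolP; exists F; split=> //.
    by move=> e; apply/eqP; exact: rF.
  by apply: monic_neq0; apply: monic_map.
have [n /asboolP[g [Ig g0 sg]] minn] := ex_minnP exP.
have [sg1|/closed_rootP[be rbe]] := eqVneq (size (map_poly al g)) 1%N.
  exfalso; have [m [C hC]] := horner_det_ideal mF rF Ig.
  have /eqP := adh _ hC; rewrite -det_map_mx map_horner_mx.
  have [c c0 ->] := size_poly1P _ (introT eqP sg1).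
  by rewrite horner_mx_C det_scalar expf_eq0 (negbTE c0) andbF.
exists be => g' Ig'.
(* The quotient is lifted through the section [s] of [al], so that the remainder is again the image
   of a relation and minimality forces it to be zero. *)
pose u : {poly Q} :=
  \poly_(i < size (map_poly al g' %/ map_poly al g)) s (map_poly al g' %/ map_poly al g)`_i.
have alu : map_poly al u = map_poly al g' %/ map_poly al g.
  apply/polyP => i; rewrite coef_map coef_poly; case: ltnP => //= h.
  by rewrite rmorph0 nth_default.
have r0 : map_poly al g' %% map_poly al g = 0.
  apply/eqP; apply: contrapT => /negP r0.
  have : P (size (map_poly al g' %% map_poly al g)).
    apply/asboolP; exists (g' - u * g).
    have -> : map_poly al (g' - u * g) = map_poly al g' %% map_poly al g.
      rewrite rmorphB rmorphM /= alu {1}[map_poly al g'](divp_eq _ (map_poly al g)).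
      by rewrite addrAC subrr add0r.
    split=> // e.
    by rewrite rmorphB rmorphM hornerD hornerN hornerM Ig' Ig mulr0 subr0.
  by move=> /minn; rewrite leqNgt -sg ltn_modp g0.
rewrite (divp_eq (map_poly al g') (map_poly al g)) r0 addr0 hornerM.
by move/eqP: rbe => ->; rewrite mulr0.
Qed.

(** One root is adjoined at a time, as a new polynomial variable. Adherence is kept in the
    conclusion: the induction needs it, and it carries every polynomial relation among the [b i]
    over to [al']. *)
Lemma lying_over (I : eqType) (s : seq I) (Q : comNzRingType)
    (ev : E -> {rmorphism Q -> K}) (al : {rmorphism Q -> K})
    (F : I -> {poly Q}) (b : I -> E -> K) :
  (forall x, exists q, al q = x) -> adherent ev al ->
  (forall i, F i \is monic) -> (forall i e, root (map_poly (ev e) (F i)) (b i e)) ->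
  exists (Q' : comNzRingType) (io : {rmorphism Q -> Q'})
    (ev' : E -> {rmorphism Q' -> K}) (al' : {rmorphism Q' -> K}) (t : I -> Q'),
  [/\ forall e q, ev' e (io q) = ev e q, forall q, al' (io q) = al q,
      forall e i, i \in s -> ev' e (t i) = b i e & adherent ev' al'].
Proof.
move=> surj adh mF rF; elim: s => [|i s].
  by exists Q, idfun, ev, al, (fun=> 0).
move=> [Q' [io [ev' [al' [t [ev'E al'E tE adh']]]]]].
have [||||be hbe] := @lying_over1 Q' ev' al' (map_poly io (F i)) (b i).
- by move=> x; have [q <-] := surj x; exists (io q).
- exact: adh'.
- exact: monic_map.
- move=> e; rewrite -map_poly_comp_id0 ?rmorph0 //=.
  by rewrite (eq_map_poly (g := ev e)) //; exact: ev'E.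
exists {poly Q'}, (polyC \o io),
  (fun e => horner_eval (b i e) \o map_poly (ev' e)),
  (horner_eval be \o map_poly al'), (fun l => if l == i then 'X else (t l)%:P).
split.
- by move=> e q; rewrite /= /horner_eval map_polyC hornerC; exact: ev'E.
- by move=> q; rewrite /= /horner_eval map_polyC hornerC; exact: al'E.
- move=> e l; rewrite inE /= /horner_eval; case: eqP => [-> _|_ /= ls].
    by rewrite map_polyX hornerX.
  by rewrite map_polyC hornerC; exact: tE.
- exact: hbe.
Qed.

End LyingOver.

(** [alg] is a predicate on functions, whereas integrality and lying over need a ring with
    evaluation morphisms. The polynomial ring links the two; [alg_eval] gives the passage back from
    functions to ring elements. *)
Lemma free_algebra (K : fieldType) n :
  exists (Q : comNzRingType) (X : 'I_n -> Q) (C : K -> Q)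
    (ev : ('I_n -> K) -> {rmorphism Q -> K}),
  [/\ forall v i, ev v (X i) = v i, forall v c, ev v (C c) = c &
      forall q, alg (coords (fun i (v : 'I_n -> K) => v i)) (fun v => ev v q)].
Proof.
exists {mpoly K[n]}, (fun i => 'X_i), (@mpolyC n K), (fun v => meval v).
split=> [v i|v c|q]; [exact: mevalXU|exact: mevalC|].
apply: alg_ext (fun v => esym (mevalE v q)) _.
apply: alg_sum => m _; apply: alg_mul; first exact: alg_cst.
by apply: alg_prod => i _; apply: alg_exp; apply: alg_base; exists i.
Qed.

Lemma alg_eval (K : fieldType) (I J : Type) (Q : comNzRingType)
    (phi : J -> {rmorphism Q -> K}) (C : K -> Q) (t : I -> Q) h :
  (forall j c, phi j (C c) = c) ->
  alg (coords (fun i (v : I -> K) => v i)) h ->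
  exists q, forall j, phi j q = h (fun i => phi j (t i)).
Proof.
move=> phiC; elim=> {h} [_ [i ->]|c|f g _ [p pE] _ [q qE]|f g _ [p pE] _ [q qE]].
- by exists (t i).
- by exists (C c) => j; rewrite phiC.
- by exists (p + q) => j; rewrite rmorphD pE qE.
- by exists (p * q) => j; rewrite rmorphM pE qE.
Qed.

Lemma genby_separated (K : fieldType) (X : fspace K) (B : (X -> K) -> Prop) :
  genby B -> (forall x y, x <> y -> exists2 b, B b & b x != b y) ->
  is_separated X.
Proof.
move=> gB sep; rewrite /is_separated -openC; apply: open_local => p /= /sep[b Bb bp].
have [hP _] := prod_genby (fun _ : bool => gB).
exists [set q | b (q true) - b (q false) != 0]; split.
- apply: (open_neq0 (X := prod_space (fun _ : bool => X))
    (b := fun q => b (q true) - b (q false))).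
  apply: reg_alg hP _; apply: alg_sub; apply: alg_base.
    by exists true, b.
  by exists false, b.
- by rewrite /= subr_eq0.
- by move=> q /= + qE; rewrite qE subrr eqxx.
Qed.

(** * The space Delta(X) *)

Section Delta.
Variables (K : numClosedFieldType) (k r : nat).
Local Notation weights := ('I_k -> 'I_r -> K).

Definition good (m : weights) := forall S : {set 'I_k},
  S != finset.set0 -> ~ (forall j : 'I_r, \sum_(i in S) m i j = 0).

Definition pairing (X : Type) (m : weights) (x : 'I_k -> X) (j : 'I_r)
  (f : X -> K) := \sum_i m i j * f (x i).

(* The tuple of cycles [\sum_i m_i [x_i]] is encoded by its pairings with all
   functions, so that the push-forward needs no choice of [x]. *)
Definition delta_set (X : Type) : set (weights * ('I_r -> (X -> K) -> K)) :=
  [set p | good p.1 /\ exists x, p.2 = pairing p.1 x].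

Definition delta_gen (X : fspace K) (f : set_type (@delta_set X) -> K) :=
  (exists i j, f = fun p => (val p).1 i j) \/
  (exists j (a : X -> K), reg setT a /\ f = fun p => (val p).2 j a).

Definition delta (X : fspace K) : fspace K :=
  gen_space (fun U f => U = setT /\ @delta_gen X f).

Lemma delta_genby X : genby (X := delta X) (@delta_gen X).
Proof.
apply: gen_space_genby => [b hb|U f [-> hf]]; first by split.
move=> x _; exists f, (fun=> 1); split; [exact: alg_base|exact: alg_cst| |].
  exact: oner_neq0.
by move=> y _; rewrite divr1.
Qed.

Definition delta_pt (X : fspace K) (m : weights) (gm : good m)
    (x : 'I_k -> X) : delta X :=
  exist _ (m, pairing m x) (mem_set (conj gm (ex_intro _ x erefl))).

Lemma delta_ptP X (p : delta X) :
  exists (gm : good (val p).1) x, p = delta_pt gm x.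
Proof.
have [gm [x px]] := set_mem (valP p); exists gm, x.
by apply: val_inj; rewrite /= -px; exact: surjective_pairing.
Qed.

(** Points record pairings with all functions, but only regular functions give generators. On the
    finitely many points of two representing tuples every function agrees with a regular one, by
    [interpolation]. *)
Lemma delta_sep (X : fspace K) n (xi : 'I_n -> X -> K) (p q : delta X) :
  chart xi -> p <> q -> exists2 b, delta_gen b & b p != b q.
Proof.
move=> [gX sepX _] pq; apply: contrapT => h.
have {}h b : delta_gen b -> b p = b q.
  by move=> gb; apply/eqP; apply: contrapT => /negP bpq; apply: h; exists b.
have [gm [x pE]] := delta_ptP p; have [gm' [x' qE]] := delta_ptP q.
have mE : (val p).1 = (val q).1.
  apply/funext => i; apply/funext => j.
  by apply: (h (fun p => (val p).1 i j)); left; exists i, j.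
apply: pq; apply: val_inj; rewrite [LHS]surjective_pairing [RHS]surjective_pairing.
congr (_, _); first exact: mE.
apply/funext => j; apply/funext => f.
have sepX' y z : y <> z -> exists2 a, coords xi a & a y != a z.
  by move=> /sepX[l yz]; exists (xi l) => //; exists l.
have [a Pa af] := interpolation ([seq x i | i <- enum 'I_k] ++
  [seq x' i | i <- enum 'I_k]) f sepX'.
have ra : reg setT a by exact: reg_alg gX.1 Pa.
have : (val p).2 j a = (val q).2 j a.
  by apply: (h (fun p => (val p).2 j a)); right; exists j, a.
rewrite pE qE /= /pairing => e.
transitivity (\sum_i (val p).1 i j * a (x i)).
  by apply: eq_bigr => i _; rewrite af // mem_cat map_f // mem_enum.
by rewrite e; apply: eq_bigr => i _; rewrite af // mem_cat orbC map_f // mem_enum.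
Qed.

(** * Affine charts of Delta(X) *)

Section DeltaChart.
Variables (X : fspace K) (J : {set 'I_k} -> 'I_r).
Variables (n : nat) (xi : 'I_n -> X -> K).
Hypothesis chX : chart xi.
Hypothesis regX : forall a : X -> K, reg setT a -> alg (coords xi) a.

Definition subsum (m : weights) (S : {set 'I_k}) := \sum_(i in S) m i (J S).

Definition delta_open : set (delta X) :=
  [set p | forall S, S != finset.set0 -> subsum (val p).1 S != 0].

Lemma delta_open_open : open delta_open.
Proof.
have -> : delta_open = [set p : delta X |
    \prod_(S : {set 'I_k} | S != finset.set0) subsum (val p).1 S != 0].
  apply/seteqP; split=> p /=; first by move=> h; apply/prodf_neq0.
  by move=> /prodf_neq0 h S; exact: h.
apply: (open_neq0 (X := delta X)
  (b := fun p => \prod_(S | S != finset.set0) subsum (val p).1 S)).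
apply: (reg_alg (delta_genby X).1); apply: alg_prod => S _.
apply: alg_sum => i _; apply: alg_base; left; by exists i, (J S).
Qed.

Let Y := sub_space delta_open.

(** Weights in the chart together with ordered points of [X]. Functions on the chart [Y] are studied
    through their pull-back along the surjection [pt]. *)
Let E := {e : weights * ('I_k -> X) |
  forall S, S != finset.set0 -> subsum e.1 S != 0}.

Let E_good (e : E) : good (proj1_sig e).1.
Proof.
by move=> S S0 h; have /eqP := proj2_sig e S S0; apply; rewrite /subsum h.
Qed.

Let pt (e : E) : Y :=
  exist _ (delta_pt (@E_good e) (proj1_sig e).2)
    (mem_set (proj2_sig e : delta_open (delta_pt (@E_good e) _))).

Let pt_surj (p : Y) : exists e, p = pt e.
Proof.
have [gm [x pE]] := delta_ptP (val p).
have Up : forall S, S != finset.set0 -> subsum (val (val p)).1 S != 0.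
  exact: set_mem (valP p).
exists (exist _ ((val (val p)).1, x) Up); apply: val_inj => /=.
by rewrite [LHS]pE; apply: val_inj.
Qed.

Let mon (b : 'I_n -> nat) (x : X) := \prod_l xi l x ^+ b l.

Let gens A (f : E -> K) :=
  [\/ exists i j, f = fun e => (proj1_sig e).1 i j,
      exists S, f = fun e => (subsum (proj1_sig e).1 S)^-1 |
      exists j b, A b /\ f = fun e => pairing (proj1_sig e).1 (proj1_sig e).2 j (mon b)].

Let gens_sub (A A' : set ('I_n -> nat)) f : A `<=` A' -> gens A f -> gens A' f.
Proof.
move=> AA' [h|h|[j [b [Ab ->]]]]; [exact: Or31|exact: Or32|apply: Or33].
by exists j, b; split=> //; exact: AA'.
Qed.

Let alg_pairing A j a :
  (forall b, alg (gens A) (fun e => pairing (proj1_sig e).1 (proj1_sig e).2 j (mon b))) ->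
  reg setT a ->
  alg (gens A) (fun e => pairing (proj1_sig e).1 (proj1_sig e).2 j a).
Proof.
move=> hA /regX/alg_filt[d]; elim=> {d a} [d _ b [c ->] _|d f g _ Hf _ Hg].
  apply: alg_ext (alg_mul (alg_cst _ c) (hA b)) => e.
  by rewrite /pairing mulr_sumr; apply: eq_bigr => i _; rewrite mulrCA.
apply: alg_ext (alg_add Hf Hg) => e.
by rewrite /pairing -big_split; apply: eq_bigr => i _; rewrite mulrDr.
Qed.

Let bounded D := [set b : 'I_n -> nat | forall l, (b l < D)%N].

Let xi_integral l : exists D (c : nat -> E -> K),
  (forall a, alg (gens (bounded k.+1)) (c a)) /\
  forall e i, xi l ((proj1_sig e).2 i) ^+ D =
    \sum_(a < D) c a e * xi l ((proj1_sig e).2 i) ^+ a.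
Proof.
pose I := ('I_k * 'I_r + ({set 'I_k} + 'I_k.+1 * 'I_r))%type.
pose pow (a : nat) (l' : 'I_n) := if l' == l then a else 0%N.
pose g (t : I) (e : E) := match t with
  | inl (i, j) => (proj1_sig e).1 i j
  | inr (inl A) => (subsum (proj1_sig e).1 A)^-1
  | inr (inr (a, j)) => pairing (proj1_sig e).1 (proj1_sig e).2 j (mon (pow a))
  end.
have monE a x : mon (pow a) x = xi l x ^+ a.
  rewrite /mon (bigD1 l) //= /pow eqxx big1 ?mulr1 // => l' /negbTE ->.
  by rewrite expr0.
have [Q [Z [C [evq [evZ _ evalg]]]]] := free_algebra K #|{: I}|.
pose ev (e : E) := evq (fun u => g (enum_val u) e).
have evE e t : ev e (Z (enum_rank t)) = g t e by rewrite evZ enum_rankK.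
have [||F mF rF] := @integrality K Q E k r ev
  (fun i e => xi l ((proj1_sig e).2 i)) (fun i j => Z (enum_rank (inl (i, j) : I)))
  (* [inord a] has value [a] for [a <= k], the range in which [integrality] asks for moments. *)
  (fun a j => Z (enum_rank (inr (inr (inord a, j)) : I))) J
  (fun S => Z (enum_rank (inr (inl S) : I))).
- move=> e a j /andP[_ ak]; rewrite evE /= inordK ?ltnS // /pairing.
  by apply: eq_bigr => i _; rewrite evE /= monE.
- move=> e S S0; rewrite evE /=; under eq_bigr do rewrite evE /=.
  by apply: mulVf; exact: (proj2_sig e).
have lF : F`_(size F).-1 = 1 by apply/eqP; move: mF; rewrite monicE.
exists (size F).-1, (fun a e => - ev e F`_a); split.
  move=> a; apply: alg_opp.
  apply: (alg_comp (phi := fun e u => g (enum_val u) e)) (evalg F`_a).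
  move=> _ [u ->]; apply: alg_base; rewrite /comp.
  case: (enum_val u) => [[i j]|[S|[b j]]] /=.
  - by apply: Or31; exists i, j.
  - by apply: Or32; exists S.
  - apply: Or33; exists j, (pow b); split=> // l'.
    by rewrite /pow; case: eqP.
move=> e i; have := rF e i.
rewrite /root horner_coef size_map_poly_id0; last first.
  by rewrite lead_coefE lF rmorph1 oner_neq0.
have -> : size F = (size F).-1.+1.
  by rewrite prednK // size_poly_gt0 monic_neq0.
rewrite big_ord_recr /=.
have -> : (map_poly (ev e) F)`_(size F).-1 = 1.
  by rewrite coef_map lF; exact: rmorph1.
rewrite mul1r addrC addr_eq0 => /eqP ->; rewrite -sumrN.
by apply: eq_bigr => a _; rewrite mulNr coef_map.
Qed.

(** An exponent of [xi l] that reaches the degree [D l] of its integral equation can be lowered, so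
    by induction on total degree finitely many moments generate the others. *)
Let gens_bounded : exists2 D, (k < D)%N & forall j a, reg setT a ->
  alg (gens (bounded D))
    (fun e => pairing (proj1_sig e).1 (proj1_sig e).2 j a).
Proof.
have [D hD] := choice xi_integral.
(* The summand [k] retains the moments that occur in the integral equations, and the sum dominates
   every [D l]. *)
exists (k + \sum_l D l).+1 => [|j a]; first by rewrite ltnS leq_addr.
apply: alg_pairing => b.
set D' := (k + _).+1.
have [N] := ubnP (\sum_l b l)%N; elim: N b => // N IH b; rewrite ltnS => bN.
have [bb|] := pselect (forall l, (b l < D')%N).
  by apply: alg_base; apply: Or33; exists j, b.
move=> /existsNP[l /negP]; rewrite -leqNgt => Db.
have Dlb : (D l <= b l)%N.
  apply: leq_trans Db; rewrite leqW // (bigD1 l) //= addnCA leq_addr //.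
pose b' a l' := if l' == l then (b l - D l + a)%N else b l'.
have [c [cA cE]] := hD l.
apply: (@alg_ext _ _ _ (fun e => \sum_(a < D l) c a e *
    pairing (proj1_sig e).1 (proj1_sig e).2 j (mon (b' a)))).
  move=> e; rewrite /pairing; under eq_bigr do rewrite mulr_sumr.
  rewrite exchange_big; apply: eq_bigr => i _ /=.
  under eq_bigr do rewrite mulrCA; rewrite -mulr_sumr; congr (_ * _).
  rewrite /mon [RHS](bigD1 l) //= -(subnK Dlb) exprD cE.
  rewrite mulr_sumr mulr_suml; apply: eq_bigr => d _.
  rewrite (bigD1 l) //= /b' eqxx exprD -!mulrA mulrCA; congr (_ * (_ * (_ * _))).
  by apply: eq_bigr => l' /negbTE ->.
apply: alg_sum => d _; apply: alg_mul.
  apply: alg_trans (cA d) => f Gf; apply: alg_base; apply: gens_sub Gf => b0 hb0 l'.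
  by apply: leq_trans (hb0 l') _; rewrite ltnS leq_addr.
apply: IH; apply: leq_trans bN; rewrite (bigD1 l) //= [X in (_ < X)%N](bigD1 l) //=.
rewrite /b' eqxx (eq_bigr b) ?ltn_add2r; last by move=> l' /negbTE ->.
by rewrite -{2}(subnK Dlb) ltn_add2l.
Qed.

(** The finitely many [ze] generate, by [gens_bounded]. For closedness, a [v] satisfying all
    equations of the image is adherent to it. Lying over extends [v] to values for the coordinates
    of the points [x_i], and relations valid on [E] persist: the equations of [X] and the formulas
    for inverse sums and moments. So [v] lies in the image. *)
Lemma delta_open_affine : is_affine (sub_space delta_open).
Proof.
have [D kD hD] := gens_bounded.
pose I := ('I_k * 'I_r + ({set 'I_k} + 'I_r * {ffun 'I_n -> 'I_D}))%type.
pose g (t : I) (p : Y) := match t with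
  | inl (i, j) => (val (val p)).1 i j
  | inr (inl A) => (subsum (val (val p)).1 A)^-1
  | inr (inr (j, b)) => (val (val p)).2 j (mon (fun l => b l))
  end.
pose ze (u : 'I_#|{: I}|) := g (enum_val u).
have gensZ f : alg (gens (bounded D)) f -> alg (coords (fun u e => ze u (pt e))) f.
  move=> Gf; apply: alg_trans Gf => _ [[i [j ->]]|[S ->]|[j [b [bD ->]]]];
      apply: alg_base.
  - by exists (enum_rank (inl (i, j) : I)); rewrite /ze enum_rankK.
  - by exists (enum_rank (inr (inl S) : I)); rewrite /ze enum_rankK.
  - exists (enum_rank (inr (inr (j, [ffun l => Ordinal (bD l)])) : I)).
    rewrite /ze enum_rankK /=; apply/funext => e; congr (pairing _ _ _ (mon _)).
    by apply/funext => l; rewrite ffunE.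
have transfer f : alg (gens (bounded D)) (f \o pt) -> alg (coords ze) f.
  move=> /gensZ/coords_lift[h Ph fE].
  apply: (@alg_ext _ _ _ (fun p => h (fun u => ze u p))).
    by move=> p; have [e ->] := pt_surj p; rewrite -fE.
  apply: (alg_comp (phi := fun p u => ze u p)) Ph.
  by move=> _ [u ->]; apply: alg_base; exists u.
have genZ f : delta_gen f -> alg (coords ze) (f \o val).
  move=> [[i [j ->]]|[j [a [ra ->]]]]; apply: transfer; last exact: hD.
  by apply: alg_base; apply: Or31; exists i, j.
have gY := sub_genby delta_open (@delta_genby X).
have regw i j : reg (f := Y) setT (fun p => (val (val p)).1 i j).
  by apply: gY.1; exists (fun p => (val p).1 i j); split=> //; left; exists i, j.
have [rext _ _ rcst _ _ _] := fspaceP Y.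
have regZ u : reg (f := Y) setT (ze u).
  rewrite /ze; case: (enum_val u) => [[i j]|[S|[j b]]] /=; first exact: regw.
    (* For empty [S] the inverse of the zero sum is 0 by convention, so this coordinate is
       constant. *)
    have [->|S0] := eqVneq S finset.set0.
      apply: (rext _ (fun=> 0)) => [p _|]; last exact: rcst openT.
      by rewrite /= /subsum big_set0 invr0.
    apply: (locq_reg (B := @reg K Y setT)) => // p _.
    exists (fun=> 1), (fun p => subsum (val (val p)).1 S); split.
    - by apply: alg_cst.
    - by apply: alg_sum => i _; apply: alg_base; exact: regw.
    - exact: (set_mem (valP p)).
    - by move=> q _; rewrite div1r.
  apply: gY.1; exists (fun p => (val p).2 j (mon (fun l => b l))); split=> //; right.
  exists j, (mon (fun l => b l)); split=> //; have [gX _ _] := chX; apply: (reg_alg gX.1).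
  by apply: alg_prod => l _; apply: alg_exp; apply: alg_base; exists l.
apply: (@chart_affine _ _ _ ze); split.
- apply: genby_trans gY _ _; last by move=> _ [u ->].
  by move=> _ [b [/genZ ? ->]].
- move=> p q pq; apply: contrapT => /forallNP h; apply: pq; apply: val_inj.
  apply: contrapT => /(delta_sep chX)[b /genZ/coords_lift[b' _ bE]] /eqP; apply.
  rewrite -[b (val p)]/((b \o val) p) -[b (val q)]/((b \o val) q) !bE.
  congr b'; apply/funext => u; apply/eqP; apply: contrapT => /negP; exact: h.
rewrite -openC; apply: open_local => v nZv.
have [Q [Z [C [evq [evZ evC evalg]]]]] := free_algebra K #|{: I}|.
suff [q [qv qZ]] : exists q, evq v q != 0 /\
    forall e, evq (fun u => ze u (pt e)) q = 0.
  exists [set w | evq w q != 0]; split=> //.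
    apply: (open_neq0 (X := affine_space K _) (b := fun w => evq w q)).
    apply: (reg_alg (affine_space_genby K _).1).
    by apply: alg_trans (evalg q) => b [u ->]; apply: alg_base; exists u.
  move=> w /= + [p wE]; have [e pE] := pt_surj p.
  rewrite (_ : w = fun u => ze u (pt e)) ?qZ ?eqxx //.
  by apply/funext => u; rewrite wE pE.
apply: contrapT => /forallNP nq; apply: nZv.
pose ev (e : E) := evq (fun u => ze u (pt e)).
have adh : adherent ev (evq v).
  by move=> q hq; apply/eqP; apply: contrapT => /negP qv; apply: (nq q); split.
have evE e t : ev e (Z (enum_rank t)) = g t (pt e).
  by rewrite evZ /ze enum_rankK.
pose b (il : 'I_k * 'I_n) (e : E) := xi il.2 ((proj1_sig e).2 il.1).
have /choice[F /all_and2[mF rF]] il : exists F : {poly Q}, F \is monic /\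
    forall e, root (map_poly (ev e) F) (b il e).
  have [d [c [cA cE]]] := xi_integral il.2.
  have /choice[q qE] a : exists q, forall e, ev e q = - c a e.
    have /gensZ/coords_lift[h Ph hE] : alg (gens (bounded D)) (c a).
      apply: alg_trans (cA a) => f Gf; apply: alg_base; apply: gens_sub Gf.
      by move=> b0 hb0 l; exact: leq_trans (hb0 l) kD.
    have [q qE] := alg_eval Z (fun e => evC (fun u => ze u (pt e)))
      (alg_mul (alg_cst _ (-1)) Ph).
    exists q => e; rewrite qE mulN1r hE; congr (- h _).
    by apply/funext => u; rewrite evZ.
  exists ('X^d + \poly_(a < d) q a); split.
    by rewrite monicE lead_coefDl ?lead_coefXn // size_polyXn ltnS size_poly.
  move=> e; rewrite /root rmorphD /= map_polyXn hornerD hornerXn cE.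
  rewrite (@horner_coef_wide _ d); last first.
    by apply: leq_trans (size_poly _ _); exact: size_poly.
  rewrite -big_split big1 //= => a _.
  have -> : (map_poly (ev e) (\poly_(a < d) q a))`_a = - c a e.
    by rewrite coef_map coef_poly ltn_ord; exact: qE.
  by rewrite mulNr subrr.
have [|Q' [io [ev' [al' [t [ev'E al'E tE adh']]]]]] :=
  lying_over (enum {: 'I_k * 'I_n}) _ adh mF rF.
  by move=> c; exists (C c); rewrite evC.
have {}tE e i l : ev' e (t (i, l)) = xi l ((proj1_sig e).2 i).
  by rewrite tE // mem_enum.
pose w t := v (enum_rank t).
have wE t0 : evq v (Z (enum_rank t0)) = w t0 by rewrite evZ.
have [_ _ cX] := chX.
have /choice[x xE] i : exists x, forall l, al' (t (i, l)) = xi l x.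
  apply: contrapT => /(closed_separated cX)[h [Ph /eqP h0 hX]]; apply: h0.
  (* [None] adds the limit [al'] to the evaluations, so that a single [q] represents [h] at all of
     them. *)
  pose phi (o : option E) := if o is Some e then ev' e else al'.
  have phiC o c : phi o (io (C c)) = c.
    by case: o => [e|] /=; rewrite ?ev'E ?al'E evC.
  have [q qE] := alg_eval (fun l => t (i, l)) phiC Ph.
  rewrite -(qE None); apply: adh' => e; rewrite (qE (Some e)); apply: hX.
  by exists ((proj1_sig e).2 i) => l; rewrite /= tE.
pose m i j := w (inl (i, j)).
have sub1 S : S != finset.set0 -> w (inr (inl S)) * subsum m S = 1.
  move=> S0; apply/eqP; rewrite -subr_eq0; apply/eqP.
  have mor (f : {rmorphism Q -> K}) : f (Z (enum_rank (inr (inl S) : I)) *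
      \sum_(i in S) Z (enum_rank (inl (i, J S) : I)) - 1) =
      f (Z (enum_rank (inr (inl S) : I))) *
      \sum_(i in S) f (Z (enum_rank (inl (i, J S) : I))) - 1.
    by rewrite rmorphB rmorphM rmorph_sum rmorph1.
  have := adh (Z (enum_rank (inr (inl S) : I)) *
    \sum_(i in S) Z (enum_rank (inl (i, J S) : I)) - 1).
  rewrite mor wE (eq_bigr (fun i => m i (J S))) => [h|i _]; last exact: wE.
  apply: h => e; rewrite mor evE; under eq_bigr do rewrite evE.
  by rewrite /= mulVf ?subrr //; exact: (proj2_sig e).
have mJ S : S != finset.set0 -> subsum (m, x).1 S != 0.
  by move=> /sub1 h; apply: contra_eq_neq h => ->; rewrite mulr0 eq_sym oner_eq0.
exists (pt (exist _ (m, x) mJ)) => u.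
have -> : v u = w (enum_val u) by rewrite /w enum_valK.
rewrite /ze; case: (enum_val u) => [[i j]|[S|[j b0]]] //=.
  have [->|S0] := eqVneq S finset.set0.
    rewrite /subsum big_set0 invr0 -wE; apply: adh => e.
    by rewrite evE /= /subsum big_set0 invr0.
  by apply: (mulIf (mJ S S0)); rewrite sub1 // mulVf ?mJ.
apply/eqP; rewrite -subr_eq0; apply/eqP.
(* The formula for the moment, written in [Q'], vanishes on [E] and hence at [al']. *)
have := adh' (io (Z (enum_rank (inr (inr (j, b0)) : I))) -
  \sum_i io (Z (enum_rank (inl (i, j) : I))) * \prod_l t (i, l) ^+ b0 l).
have mor (f : {rmorphism Q' -> K}) : f (io (Z (enum_rank (inr (inr (j, b0)) : I))) -
  \sum_i io (Z (enum_rank (inl (i, j) : I))) * \prod_l t (i, l) ^+ b0 l) =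
  f (io (Z (enum_rank (inr (inr (j, b0)) : I)))) -
  \sum_i f (io (Z (enum_rank (inl (i, j) : I)))) * \prod_l f (t (i, l)) ^+ b0 l.
  rewrite rmorphB rmorph_sum; congr (_ - _); apply: eq_bigr => i _.
  rewrite rmorphM rmorph_prod; congr (_ * _); apply: eq_bigr => l _.
  by rewrite rmorphXn.
rewrite mor al'E wE => h; rewrite -[RHS]h => [|e].
  congr (_ - _); rewrite /pairing; apply: eq_bigr => i _.
  rewrite al'E wE; congr (_ * _); apply: eq_bigr => l _; by rewrite xE.
rewrite mor ev'E evE /= /pairing; apply/eqP; rewrite subr_eq0; apply/eqP.
apply: eq_bigr => i _; rewrite ev'E evE /=; congr (_ * _).
by apply: eq_bigr => l _; rewrite tE.
Qed.

End DeltaChart.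
End Delta.

(** * Variety structure and functoriality *)

Section DeltaVariety.
Variables (K : numClosedFieldType) (k r : nat).
Hypothesis pigeonK : pigeonhole K.
Hypothesis r_gt0 : (0 < r)%N.

(** There is one chart for each choice of a coordinate for every subset. They cover because goodness
    makes some coordinate of each nonempty subset sum nonzero. *)
Lemma delta_variety (X : fspace K) : is_affine X -> is_variety (delta k r X).
Proof.
move=> /affine_chart[n [xi chX]]; split.
  by apply: genby_separated (@delta_genby K k r X) _ => p q; exact: delta_sep chX.
pose T := {ffun {set 'I_k} -> 'I_r}.
exists #|{: T}|, (fun u => delta_open (X := X) (enum_val u : T)); split.
- by move=> u; exact: delta_open_open.
- move=> u; apply: (delta_open_affine (enum_val u : T) chX) => a.
  exact: chart_reg.
apply/seteqP; split=> // p _.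
have [gm _] := delta_ptP p.
have /choice[J hJ] (S : {set 'I_k}) : exists j : 'I_r,
    S != finset.set0 -> \sum_(i in S) (val p).1 i j != 0.
  have [->|S0] := eqVneq S finset.set0; first by exists (Ordinal r_gt0).
  have /existsNP[j /eqP hj] := gm S S0; by exists j.
exists (enum_rank ([ffun S => J S] : T)) => //= S S0.
by rewrite enum_rankK /subsum ffunE; exact: hJ.
Qed.

Definition delta_str (X : fspace K) (p : delta k r X) : good_weights K k r :=
  exist _ (val p).1 (mem_set (set_mem (valP p)).1).

Lemma delta_str_morph (X : fspace K) : is_morph (@delta_str X).
Proof.
have gW := sub_genby [set m : weight_space K k r | good m]
  (prod_genby (fun _ : 'I_k => affine_space_genby K r)).
apply: (morph_genby gW) => _ [_ [[i [_ [[j ->] ->]]] ->]].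
by apply: (@delta_genby K k r X).1; left; exists i, j.
Qed.

(** Push-forward of functionals. A tuple of points occurs only in the membership proof, so the
    functor laws are immediate. *)
Definition delta_map (X Y : fspace K) (f : X -> Y) (p : delta k r X) :
  delta k r Y.
Proof.
exists ((val p).1, fun j g => (val p).2 j (g \o f)); apply/mem_set.
have [gm [x px]] := set_mem (valP p); split=> //=.
by exists (f \o x); rewrite px.
Defined.

Lemma delta_map_morph (X Y : fspace K) (f : morph X Y) :
  is_morph (delta_map f).
Proof.
have [_ rf] := morphP f.
apply: morph_genby (@delta_genby K k r Y) _.
move=> _ [[i [j ->]]|[j [a [ra ->]]]]; apply: (@delta_genby K k r X).1.
  by left; exists i, j.
by right; exists j, (a \o f); split=> //; exact: (rf setT a openT ra).
Qed.

Definition delta_over (X : affine_variety K) : variety_over (good_weights K k r) :=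
  VarietyOver (delta_variety (avarP X)) (Morph (@delta_str_morph X)).

Definition delta_map_over (X Y : affine_variety K) (f : morph X Y) :
  morph_over (delta_over X) (delta_over Y).
Proof.
exists (Morph (delta_map_morph f)) => p; exact: val_inj.
Defined.

Definition delta_functor : affine_functor (good_weights K k r).
Proof.
exists delta_over delta_map_over.
- by move=> X p; apply: val_inj; rewrite /= [RHS]surjective_pairing.
- by move=> X Y Z g f p; exact: val_inj.
Defined.

(** * The fibre over integral weights *)

Variable P : 'I_k -> 'I_r -> nat.
Hypothesis P_neq0 : forall i, exists j, P i j <> 0%N.

Let w : 'I_k -> 'I_r -> K := fun i j => (P i j)%:R.

(** A sum of natural numbers vanishes in characteristic 0 only if every term does. *)
Let w_good : good w.
Proof.
move=> S /set0Pn[i iS] h; have [j] := P_neq0 i; apply.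
have /eqP := h j; rewrite -natr_sum Num.Theory.pnatr_eq0 sum_nat_eq0.
by move=> /forallP/(_ i); rewrite iS => /eqP.
Qed.

Lemma zcycle_expand (X : Type) (m : 'I_k -> nat) (x : 'I_k -> X) :
  exists z : 'I_(\sum_i m i) -> X, zcycle (fun=> 1%N) z = zcycle m x.
Proof.
pose s := flatten [seq nseq (m i) i | i <- enum 'I_k].
have ss : size s == (\sum_i m i)%N.
  rewrite size_flatten /shape -map_comp sumnE big_map big_enum.
  by apply/eqP; apply: eq_bigr => i _; rewrite /= size_nseq.
exists (x \o tnth (Tuple ss)); apply/funext => y; rewrite /zcycle.
transitivity (\sum_(i <- s) (`[< x i = y >] : nat))%N.
  by rewrite [RHS](big_tuple _ _ (Tuple ss)); apply: eq_bigr => l _; rewrite mul1n.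
rewrite big_flatten big_map big_enum; apply: eq_bigr => i _.
by rewrite big_nseq iter_addn_0 mulnC.
Qed.

Section FiberIso.
Variable X : affine_variety K.

Lemma pairing_zcycle (x x' : 'I_k -> X) : pairing w x = pairing w x' <->
  forall j, zcycle (fun i => P i j) x = zcycle (fun i => P i j) x'.
Proof.
split=> [h j|h].
  by apply: (@zcycle_eq K) => f; have /(congr1 (fun g => g j f)) := h.
by apply/funext => j; apply/funext => f; exact: zcycle_sum.
Qed.

(** On the fibre the weights are constant, and the remaining generators, pairings with regular [a],
    correspond to the power sums of [a], which generate on symmetric powers. The isomorphism is
    pinned down by its effect on representing tuples, which later gives compatibility with
    push-forward. *)
Lemma fiber_iso : exists e : iso (fiber (delta_functor X) P) (stratum P X),
  forall (p : fiber (delta_functor X) P) (x : 'I_k -> X),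
    is_incidence (sub_incl (e p)) x <->
    (val (sub_incl p : delta k r X)).2 = pairing w x.
Proof.
have [n [xi [gX _ _]]] := affine_chart (avarP X).
pose A : set (delta k r X) :=
  [set p | forall i j, sub_incl (delta_str p) i j = (P i j)%:R].
have gF := sub_genby A (@delta_genby K k r X).
have gS := sub_genby [set c : sym_power_prod P X | exists x, is_incidence c x]
  (prod_genby (fun j : 'I_r => sym_power_genby (\sum_(i < k) P i j) gX)).
have fw (p : sub_space A) : (val (val p)).1 = w.
  apply/funext => i; apply/funext => j; exact: (set_mem (valP p) i j).
have fx (p : sub_space A) : exists x, (val (val p)).2 = pairing w x.
  by have [gm [x px]] := set_mem (valP (val p)); exists x; rewrite px fw.
have sx (c : stratum P X) : exists x, is_incidence (val c) x.
  exact: set_mem (valP c).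
have /choice[f fE] (p : sub_space A) : exists c : stratum P X,
    forall x, is_incidence (val c) x <-> (val (val p)).2 = pairing w x.
  have [x px] := fx p.
  have hz j : exists c : sym_power (\sum_(i < k) P i j) X,
      multiplicity c = zcycle (fun i => P i j) x.
    by have [z zE] := zcycle_expand (fun i => P i j) x; exists (cycle_of z).
  pose c j := sval (cid (hz j)).
  have cE : is_incidence (c : sym_power_prod P X) x.
    by move=> j; exact: (svalP (cid (hz j))).
  exists (exist _ (c : sym_power_prod P X) (mem_set (ex_intro _ x cE))) => x' /=.
  rewrite px pairing_zcycle; split=> h j; first by rewrite -h cE.
  by rewrite cE h.
have /choice[g gE] (c : stratum P X) : exists p : sub_space A,
    forall x, is_incidence (val c) x <-> (val (val p)).2 = pairing w x.
  have [x cx] := sx c.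
  have Ap : A (delta_pt w_good x) by [].
  exists (exist _ (delta_pt w_good x) (mem_set Ap)) => x' /=.
  rewrite pairing_zcycle; split=> h j; first by rewrite -h cx.
  by rewrite cx h.
have fK : cancel f g.
  move=> p; have [x px] := fx p; apply: val_inj; apply: val_inj.
  have gx : (val (val (g (f p)))).2 = pairing w x by apply/gE/fE.
  rewrite [LHS]surjective_pairing [RHS]surjective_pairing px gx.
  by rewrite (fw p) (fw (g (f p))).
have gK : cancel g f.
  move=> c; have [x cx] := sx c; apply: val_inj.
  have fgx : is_incidence (val (f (g c))) x by apply/fE/gE.
  apply: functional_extensionality_dep => j; apply: val_inj.
  exact: etrans (fgx j) (esym (cx j)).
have psE j (h : sym_power (\sum_(i < k) P i j) X -> K) a c x :
    (forall z, h (cycle_of z) = \sum_l a (z l)) ->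
    multiplicity c = zcycle (fun i => P i j) x -> h c = pairing w x j a.
  have [z ->] := cycle_of_surj c => hE zx; rewrite hE.
  rewrite -[RHS](@zcycle_sum K _ _ _ (fun=> 1%N) _ z x) //.
  by apply: eq_bigr => l _; rewrite mul1r.
have [rext _ _ rcst _ _ _] := fspaceP (stratum P X).
have [||e eE] := iso_genby gF gS fK gK; last first.
- by exists e => p x; rewrite eE; exact: fE.
- move=> _ [_ [[[i [j ->]]|[j [a [ra ->]]]] ->]].
    apply: (rext _ (fun=> w i j)) => [c _|]; last exact: rcst openT.
    by rewrite /= (fw (g c)).
  have [h Ph hE] := power_sum_exists (\sum_(i < k) P i j) ra.
  apply: (rext _ (fun c : stratum P X => h (val c j))) => [c _|].
    have [x cx] := sx c; rewrite /= (psE _ _ _ _ _ hE (cx j)).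
    by have /gE -> := cx.
  by apply: gS.1; exists (fun c => h (c j)); split=> //; exists j, h.
- move=> _ [_ [[j [h [[a ra hE] ->]]] ->]].
  apply: (reg_ext (fspaceP (sub_space A))
      (f := fun p : sub_space A => (val (val p)).2 j a)) => [p _|].
    have [x px] := fx p; have cx : is_incidence (val (f p)) x by apply/fE.
    by rewrite /= (psE _ _ _ _ _ hE (cx j)) px.
  by apply: gF.1; exists (fun p => (val p).2 j a); split=> //; right; exists j, a.
Qed.

End FiberIso.

(** Naturality of the isomorphisms is expressed through representing tuples, because any one of them
    determines a point of the stratum. *)
Lemma delta_functor_fibers : exists e : forall X : affine_variety K,
    iso (fiber (delta_functor X) P) (stratum P X),
  forall (X Y : affine_variety K) (f : morph X Y)
    (p : fiber (delta_functor X) P) (q : fiber (delta_functor Y) P)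
    (x : 'I_k -> X),
    sub_incl q = functor_map delta_functor f (sub_incl p) ->
    is_incidence (sub_incl (e X p)) x ->
    is_incidence (sub_incl (e Y q)) (f \o x).
Proof.
exists (fun X => sval (cid (fiber_iso X))) => X Y f p q x qE.
move: (cid (fiber_iso X)) (cid (fiber_iso Y)) => [e he] [e' he'] /= /he px.
apply/he'.
have {}qE : (sub_incl q : delta k r Y) = delta_map f (sub_incl p) := qE.
rewrite qE; apply/funext => j; apply/funext => g.
by rewrite [LHS](congr1 (fun mu => mu j (g \o f)) px).
Qed.

End DeltaVariety.

Theorem theorem1p3 (R : realType) (k r : nat) (hk : (1 <= k)%N)
    (hr : (1 <= r)%N) :
  exists Delta : affine_functor (good_weights R[i] k r),
  forall P : 'I_k -> 'I_r -> nat, (forall i, exists j, P i j <> 0%N) ->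
  exists e : forall X : affine_variety R[i],
    iso (fiber (Delta X) P) (stratum P X),
  forall (X Y : affine_variety R[i]) (f : morph X Y)
    (p : fiber (Delta X) P) (q : fiber (Delta Y) P) (x : 'I_k -> X),
    sub_incl q = functor_map Delta f (sub_incl p) ->
    is_incidence (sub_incl (e X p)) x ->
    is_incidence (sub_incl (e Y q)) (f \o x).
Proof.
exists (delta_functor k (@complex_pigeonhole R) hr) => P hP.
exact: delta_functor_fibers.
Qed.
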